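(* Let $V$ be a complex-valued potential on $(0,\infty)$ with $\int_0^\infty |V(x)|\,dx<\infty$ (more generally, a finite complex Borel measure on $(0,\infty)$, with $\int_0^\infty|V(x)|\,dx$ denoting its total variation). Then any eigenvalue $\lambda\in\mathbb{C}\setminus[0,\infty)$ of the operator $-\partial^2-V$ in $L^2(0,\infty)$ with Dirichlet boundary conditions satisfies $$|\lambda|^{1/2}\le\int_0^\infty|V(x)|\,dx .$$ The bound is not true in general if the right side is multiplied by a constant $<1$; that is, for every constant $\kappa<1$ there exist such a $V$ and an eigenvalue $\lambda\in\mathbb{C}\setminus[0,\infty)$ of the corresponding operator with $|\lambda|^{1/2}>\kappa\int_0^\infty|V(x)|\,dx$.
   Context: Potentials are complex-valued and may be finite complex Borel measures $V$ on $(0,\infty)$; an integrable function $V$ is identified with the measure $V(x)\,dx$. The expression $\int_0^\infty|V(x)|\,dx$ denotes the $L^1$-norm of $V$, respectively the total variation of the measure $V$. The operator $-\partial^2-V$ in $L^2(0,\infty)$ with Dirichlet boundary conditions ($\psi(0)=0$) is defined in the quadratic form sense: it is the m-sectorial operator associated with the form $\psi\mapsto\int_0^\infty|\psi'(x)|^2\,dx-\int_{(0,\infty)}|\psi|^2\,dV$ with form domain $H^1_0(0,\infty)$ (elements of which are identified with their continuous representatives). *)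

(* Defs.v *)
From HB Require Import structures.
From mathcomp Require Import all_boot all_order all_algebra.
From mathcomp Require Import all_classical all_reals all_analysis.
From mathcomp.real_closed Require Import complex.

Set Implicit Arguments.
Unset Strict Implicit.
Unset Printing Implicit Defensive.

Import Order.TTheory GRing.Theory Num.Theory.
Import numFieldNormedType.Exports.

Local Open Scope classical_set_scope.
Local Open Scope ring_scope.
Local Open Scope complex_scope.

Notation cabs := ComplexField.Normc.normc.

Section complex_functions.
Context d (T : measurableType d) (R : realType).
Implicit Types (mu : {measure set T -> \bar R}) (D : set T) (f : T -> R[i]).

Definition cmeasurable D f : Prop :=
  measurable_fun D (fun x => complex.Re (f x)) /\
  measurable_fun D (fun x => complex.Im (f x)).

Definition cintegrable mu D f : Prop :=
  mu.-integrable D (fun x => (complex.Re (f x))%:E) /\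
  mu.-integrable D (fun x => (complex.Im (f x))%:E).

Definition cintegral mu D f : R[i] :=
  (\int[mu]_(x in D) complex.Re (f x)) +i* (\int[mu]_(x in D) complex.Im (f x)).

Definition square_integrable mu D f : Prop :=
  cmeasurable D f /\ mu.-integrable D (fun x => (cabs (f x) ^+ 2)%:E).

End complex_functions.

(* Charges are finite and sigma-additive, so a pair of charges is exactly a
   sigma-additive set function with values in the complex numbers. *)
Record complex_measure d (T : measurableType d) (R : realType) := ComplexMeasure
  { re_charge : {charge set T -> \bar R} ;
    im_charge : {charge set T -> \bar R} }.

Section complex_measures.
Context d (T : measurableType d) (R : realType).
Implicit Types (nu : {charge set T -> \bar R}) (V : complex_measure T R).
Implicit Types (D : set T).

Definition cmeasure V (A : set T) : R[i] :=
  fine (re_charge V A) +i* fine (im_charge V A).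

(* Countable measurable partitions F of D; some of the F k may be empty. *)
Definition complex_total_variation V D : \bar R :=
  ereal_sup [set (\sum_(0 <= k <oo) (cabs (cmeasure V (F k)))%:E)%E | F in
    [set F : (set T)^nat | [/\ forall k, measurable (F k),
                               trivIset [set: nat] F &
                               \bigcup_k F k = D]]].

Definition hahn_pos nu : set T := projT1 (cid (Hahn_decomposition nu)).

Definition hahn_neg nu : set T :=
  projT1 (cid (projT2 (cid (Hahn_decomposition nu)))).

Definition hahnP nu : hahn_decomposition nu (hahn_pos nu) (hahn_neg nu) :=
  projT2 (cid (projT2 (cid (Hahn_decomposition nu)))).

Definition charge_integral nu D (f : T -> R) : R :=
  (\int[jordan_pos (hahnP nu)]_(x in D) f x) -
  (\int[jordan_neg (hahnP nu)]_(x in D) f x).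

Definition cmeasure_integral V D (f : T -> R[i]) : R[i] :=
  let u x := complex.Re (f x) in
  let v x := complex.Im (f x) in
  (charge_integral (re_charge V) D u - charge_integral (im_charge V) D v) +i*
  (charge_integral (re_charge V) D v + charge_integral (im_charge V) D u).

End complex_measures.

Section density.
Context d (T : measurableType d) (R : realType).
Variables (mu : {measure set T -> \bar R}) (D : set T) (mD : measurable D).
Variables (f : T -> R[i]) (intf : cintegrable mu D f).

Let integrable_patch (g : T -> \bar R) :
  mu.-integrable D g -> mu.-integrable [set: T] (g \_ D).
Proof. by move/(integrable_mkcond g mD). Qed.

Definition density_measure : complex_measure T R :=
  ComplexMeasure (induced_charge (integrable_patch (proj1 intf)))
                 (induced_charge (integrable_patch (proj2 intf))).

End density.

Section half_line.
Context (R : realType).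

Local Notation leb := (@lebesgue_measure R).

Definition half_line : set (measurableTypeR R) := `]0, +oo[.

Lemma measurable_half_line : measurable half_line.
Proof. exact: measurable_itv. Qed.

(* A potential is a complex Borel measure on the line of which only the
   restriction to the half-line is ever used; every complex Borel measure on the
   half-line is such a restriction. *)
Definition potential := complex_measure (measurableTypeR R) R.

Definition function_potential (V : measurableTypeR R -> R[i])
    (intV : cintegrable leb half_line V) : potential :=
  density_measure measurable_half_line intV.

(* psi is the continuous representative of an element of H^1_0(0,oo), and dpsi
   is a representative of its weak derivative: psi is absolutely continuous with
   psi(0) = 0, and psi, psi' are in L^2(0,oo).  The values of psi outside of the
   half-line are irrelevant. *)
Definition H10 (psi dpsi : measurableTypeR R -> R[i]) : Prop :=
  [/\ square_integrable leb half_line psi,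
      square_integrable leb half_line dpsi &
      forall x : R, 0 < x -> psi x = cintegral leb `]0, x[ dpsi].

Definition L2_inner (f g : measurableTypeR R -> R[i]) : R[i] :=
  cintegral leb half_line (fun x => f x * conjc (g x)).

(* The sesquilinear form whose diagonal is the quadratic form
   psi |-> \int |psi'|^2 dx - \int |psi|^2 dV. *)
Definition schrodinger_form (V : potential)
    (psi dpsi phi dphi : measurableTypeR R -> R[i]) : R[i] :=
  L2_inner dpsi dphi - cmeasure_integral V half_line (fun x => psi x * conjc (phi x)).

(* Graph of the m-sectorial operator associated with the form by the first
   representation theorem: psi is in the domain, and is mapped to w. *)
Definition schrodinger_operator (V : potential)
    (psi w : measurableTypeR R -> R[i]) : Prop :=
  square_integrable leb half_line w /\
  exists2 dpsi, H10 psi dpsi &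
    forall phi dphi, H10 phi dphi ->
      schrodinger_form V psi dpsi phi dphi = L2_inner w phi.

Definition schrodinger_eigenvalue (V : potential) (lambda : R[i]) : Prop :=
  exists2 psi : measurableTypeR R -> R[i],
    ~ {ae leb, forall x, half_line x -> psi x = 0} &
    schrodinger_operator V psi (fun x => lambda * psi x).

Definition L1_norm (V : measurableTypeR R -> R[i]) : R :=
  \int[leb]_(x in half_line) cabs (V x).

End half_line.

Arguments half_line R : clear implicits.

(* The complement of [0,oo) in the complex plane; in R[i] the relation 0 <= z
   means that z is real and nonnegative. *)
Definition off_half_axis (R : realType) (lambda : R[i]) : Prop :=
  ~~ (0 <= lambda).

(* Main.v *)
(* Write lambda = - k^2 with Re k > 0. The Green function
   G(x, y) = (exp (-k |x - y|) - exp (-k (x + y))) / 2k of - d^2/dx^2 + k^2 with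
   a Dirichlet condition is bounded by 1 / |k|. Testing the weak equation with
   the conjugate of G(., y) turns it into psi(y) = \int psi G(., y) dV, whence
   sup |psi| <= sup |psi| |V| / |k|, which forces |k| <= |V|; psi is bounded
   because it is in H^1.

   For sharpness, G(x, x) = (1 - exp (-2kx)) / 2k has modulus close to 1 / |k|
   at x = 1 if k = e + i pi / 2 with e small; a potential concentrated on
   [1, 1 + e] is made out of an explicit eigenfunction. *)
Require Import Defs.
From mathcomp Require Import all_boot all_order all_algebra.
From mathcomp Require Import all_classical all_reals all_analysis.
From mathcomp.real_closed Require Import complex.
From mathcomp Require Import measurable_realfun ring lra.

Set Implicit Arguments.
Unset Strict Implicit.
Unset Printing Implicit Defensive.

Import Order.TTheory GRing.Theory Num.Theory.
Import numFieldNormedType.Exports.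

Local Open Scope classical_set_scope.
Local Open Scope ring_scope.
Local Open Scope complex_scope.

(** The constant 1 rests on the sharp inequality |\int f dV| <= sup |f| |V| for complex V. The
    integral is defined through the Jordan parts of Re V and Im V, and estimating these separately
    loses a factor. Therefore f is replaced by a function s with finitely many values: the integral
    of s is a finite sum of terms c_k V(A_k), which a single partition in the supremum defining |V|
    controls, and the lossy estimate is applied to f - s only.

    Elements of H^1_0 are known only as primitives of L^2 functions, so integration by parts is an
    instance of Fubini; it requires a partner function that decays exponentially, and Re k > 0
    supplies this decay.

    At Im k = pi / 2 one has exp (-2k) = - exp (-2e), so the two exponentials in G(1, 1) add up
    instead of cancelling. A point mass at 1 would need the strength k (1 + tanh e), the drop of
    psi' / psi from k tanh e to - k. For an integrable V the drop is spread over [1, 1 + e] by a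
    parabola that stays close to 1, and the L^1 norm is still |k| (1 + O(e)). *)

(** * The modulus of a complex number and its real and imaginary parts *)

Section complex_modulus.
Context {R : realType}.
Implicit Types (z w : R[i]).

Lemma cabs_ge0 z : 0 <= cabs z.
Proof. by case: z => a b /=; exact: sqrtr_ge0. Qed.

Lemma cabs_sqr z : cabs z ^+ 2 = complex.Re z ^+ 2 + complex.Im z ^+ 2.
Proof. by case: z => a b /=; rewrite sqr_sqrtr// addr_ge0// sqr_ge0. Qed.

Lemma cabsD z w : cabs (z + w) <= cabs z + cabs w.
Proof. exact: le_normcD. Qed.

Lemma cabsM z w : cabs (z * w) = cabs z * cabs w.
Proof. exact: ComplexField.Normc.normcM. Qed.

Lemma cabsN z : cabs (- z) = cabs z.
Proof. exact: normcN. Qed.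

Lemma cabsV z : cabs z^-1 = (cabs z)^-1.
Proof. exact: ComplexField.Normc.normcV. Qed.

Lemma cabs0 : cabs (0 : R[i]) = 0.
Proof. exact: ComplexField.Normc.normc0. Qed.

Lemma cabs1 : cabs (1 : R[i]) = 1.
Proof. exact: ComplexField.Normc.normc1. Qed.

Lemma cabs_eq0 z : (cabs z == 0) = (z == 0).
Proof.
by apply/eqP/eqP => [/ComplexField.Normc.eq0_normc//|->]; exact: cabs0.
Qed.

Lemma cabs_conj z : cabs (conjc z) = cabs z.
Proof. by case: z => a b /=; rewrite sqrrN. Qed.

Lemma cabs_real (x : R) : cabs x%:C = `|x|.
Proof. by rewrite /= expr0n addr0 sqrtr_sqr. Qed.

Lemma Re_le_cabs z : `|complex.Re z| <= cabs z.
Proof.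
rewrite -(@ler_pXn2r _ 2)// ?nnegrE ?cabs_ge0//.
by rewrite real_normK ?num_real// cabs_sqr lerDl sqr_ge0.
Qed.

Lemma Im_le_cabs z : `|complex.Im z| <= cabs z.
Proof.
rewrite -(@ler_pXn2r _ 2)// ?nnegrE ?cabs_ge0//.
by rewrite real_normK ?num_real// cabs_sqr lerDr sqr_ge0.
Qed.

Lemma cabs_le_ReIm z : cabs z <= `|complex.Re z| + `|complex.Im z|.
Proof.
rewrite -(@ler_pXn2r _ 2)// ?nnegrE ?cabs_ge0 ?addr_ge0//.
rewrite cabs_sqr sqrrD !real_normK ?num_real//.
by rewrite addrAC lerDl mulrn_wge0// mulr_ge0.
Qed.

Lemma cabs_sum I (r : seq I) (F : I -> R[i]) :
  cabs (\sum_(i <- r) F i) <= \sum_(i <- r) cabs (F i).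
Proof.
elim/big_ind2 : _ => //; first by rewrite cabs0.
by move=> z x w y zx wy; rewrite (le_trans (cabsD _ _))// lerD.
Qed.

Lemma ReD z w : complex.Re (z + w) = complex.Re z + complex.Re w.
Proof. by case: z; case: w. Qed.

Lemma ImD z w : complex.Im (z + w) = complex.Im z + complex.Im w.
Proof. by case: z; case: w. Qed.

Lemma ReN z : complex.Re (- z) = - complex.Re z.
Proof. by case: z. Qed.

Lemma ImN z : complex.Im (- z) = - complex.Im z.
Proof. by case: z. Qed.

Lemma ReM z w : complex.Re (z * w) =
  complex.Re z * complex.Re w - complex.Im z * complex.Im w.
Proof. by case: z; case: w. Qed.

Lemma ImM z w : complex.Im (z * w) =
  complex.Re z * complex.Im w + complex.Im z * complex.Re w.
Proof. by case: z; case: w. Qed.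

Lemma Re_sum I (r : seq I) (F : I -> R[i]) :
  complex.Re (\sum_(i <- r) F i) = \sum_(i <- r) complex.Re (F i).
Proof. by apply: big_morph => //; exact: ReD. Qed.

Lemma Im_sum I (r : seq I) (F : I -> R[i]) :
  complex.Im (\sum_(i <- r) F i) = \sum_(i <- r) complex.Im (F i).
Proof. by apply: big_morph => //; exact: ImD. Qed.

Lemma complex_eq z w : complex.Re z = complex.Re w ->
  complex.Im z = complex.Im w -> z = w.
Proof. by case: z; case: w => a b c d /= -> ->. Qed.

End complex_modulus.

(** * Bounded measurable functions on finite measure spaces *)

Section bounded_measurable.
Context d (T : measurableType d) (R : realType).
Implicit Types (mu : {finite_measure set T -> \bar R}) (D A : set T).
Implicit Types (u v : T -> R).

Definition bounded_measurable D u :=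
  measurable_fun D u /\ exists M, forall x, D x -> `|u x| <= M.

Lemma bounded_measurable_integrable mu D u : measurable D ->
  bounded_measurable D u -> mu.-integrable D (EFin \o u).
Proof.
move=> mD [mu_ [M uM]]; apply: measurable_bounded_integrable => //.
  by rewrite -ge0_fin_numE// fin_num_measure.
exists M; split; first exact: num_real.
by move=> y My x Dx; apply: le_trans (uM _ Dx) _; exact: ltW.
Qed.

Lemma bounded_measurable_cst D (r : R) : bounded_measurable D (fun=> r).
Proof. by split; [exact: measurable_cst|exists `|r|]. Qed.

Lemma bounded_measurableD D u v : bounded_measurable D u ->
  bounded_measurable D v -> bounded_measurable D (fun x => u x + v x).
Proof.
move=> [mu_ [M uM]] [mv [N vN]]; split; first exact: measurable_funD.
by exists (M + N) => x Dx; rewrite (le_trans (ler_normD _ _))// lerD ?uM ?vN.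
Qed.

Lemma bounded_measurableB D u v : bounded_measurable D u ->
  bounded_measurable D v -> bounded_measurable D (fun x => u x - v x).
Proof.
move=> bu [mv [N vN]]; apply: bounded_measurableD => //; split.
  exact: measurableT_comp.
by exists N => x Dx; rewrite normrN vN.
Qed.

Lemma Rintegral_level_sets (mu : {measure set T -> \bar R}) D u (n : nat)
    (A : nat -> set T) :
  mu.-integrable D (EFin \o u) -> measurable D ->
  (forall k, measurable (A k)) -> trivIset setT A ->
  \big[setU/set0]_(k < n) A k = D ->
  \int[mu]_(x in D) u x = \sum_(k < n) \int[mu]_(x in A k) u x.
Proof.
move=> iu mD mA tA AD; rewrite -AD in iu mD *.
elim: n iu mD {AD} => [|n IH]; first by rewrite !big_ord0 Rintegral_set0.
rewrite !big_ord_recr/= => iu mD.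
have mn : measurable (\big[setU/set0]_(k < n) A k).
  exact: bigsetU_measurable.
rewrite Rintegral_setU// ?IH//.
- by apply: integrableS iu.
- rewrite disj_set2E; apply/eqP; rewrite -bigcup_mkord setI_bigcupl.
  apply: bigcup0 => i /= ilt; move/trivIsetP : tA; apply => //.
  by rewrite neq_ltn ilt.
Qed.

End bounded_measurable.

(** * Integration of bounded functions against a real charge *)

Section charge_integral.
Context d (T : measurableType d) (R : realType).
Implicit Types (nu : {charge set T -> \bar R}) (D A : set T) (u v : T -> R).

Lemma eq_charge_integral nu D u v : {in D, u =1 v} ->
  charge_integral nu D u = charge_integral nu D v.
Proof.
by move=> uv; congr (_ - _); apply: eq_Rintegral => x xD; exact: uv.
Qed.

Lemma charge_integralB nu D u v : measurable D ->
  bounded_measurable D u -> bounded_measurable D v ->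
  charge_integral nu D (fun x => u x - v x) =
  charge_integral nu D u - charge_integral nu D v.
Proof.
move=> mD bu bv; rewrite /charge_integral.
rewrite !RintegralB//; try exact: bounded_measurable_integrable.
by ring.
Qed.

Lemma charge_integral_cst nu D (r : R) : measurable D ->
  charge_integral nu D (fun=> r) = r * fine (nu D).
Proof.
move=> mD; rewrite /charge_integral !Rintegral_cst// -mulrBr; congr (_ * _).
rewrite (jordan_decomp (hahnP nu) mD) /cadd/= cscaleN1 fineD ?fineN//.
- exact: fin_num_measure.
- by rewrite fin_numN; exact: fin_num_measure.
Qed.

Lemma charge_integral_level_sets nu D u (n : nat) (A : nat -> set T) :
  measurable D -> bounded_measurable D u ->
  (forall k, measurable (A k)) -> trivIset setT A ->
  \big[setU/set0]_(k < n) A k = D ->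
  charge_integral nu D u = \sum_(k < n) charge_integral nu (A k) u.
Proof.
move=> mD bu mA tA AD; rewrite /charge_integral.
rewrite !(Rintegral_level_sets _ _ mA tA AD)//;
  try exact: bounded_measurable_integrable.
by rewrite -sumrB.
Qed.

(** The total variation of a real charge, read off its Jordan decomposition. It is used as a finite
    constant in front of errors that tend to 0. *)
Definition charge_mass nu D : R :=
  fine (jordan_pos (hahnP nu) D) + fine (jordan_neg (hahnP nu) D).

Lemma charge_integral_le nu D u (e : R) : measurable D ->
  measurable_fun D u -> (forall x, D x -> `|u x| <= e) ->
  `|charge_integral nu D u| <= e * charge_mass nu D.
Proof.
move=> mD mu_ ue.
have bu : bounded_measurable D u by split => //; exists e.
have H (mu : {finite_measure set T -> \bar R}) :
    `|\int[mu]_(x in D) u x| <= e * fine (mu D).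
  have iu := bounded_measurable_integrable mu mD bu.
  rewrite (le_trans (le_normr_Rintegral mD iu))// -Rintegral_cst//.
  apply: le_Rintegral => //; first exact: integrable_norm.
  exact: bounded_measurable_integrable (bounded_measurable_cst _ _).
by rewrite (le_trans (ler_normB _ _))// mulrDr lerD//; exact: H.
Qed.

End charge_integral.

(** * Integration of bounded functions against a complex measure *)

Section complex_measure_integral.
Context d (T : measurableType d) (R : realType).
Implicit Types (V : complex_measure T R) (D A : set T) (f g : T -> R[i]).

Definition cbounded_measurable D f :=
  bounded_measurable D (fun x => complex.Re (f x)) /\
  bounded_measurable D (fun x => complex.Im (f x)).

Lemma cbounded_measurable_bound D f (M : R) : cmeasurable D f ->
  (forall x, D x -> cabs (f x) <= M) -> cbounded_measurable D f.
Proof.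
move=> [mr mi] fM; split; split => //; exists M => x /fM; apply: le_trans.
  exact: Re_le_cabs.
exact: Im_le_cabs.
Qed.

Lemma eq_cmeasure_integral V D f g : {in D, f =1 g} ->
  cmeasure_integral V D f = cmeasure_integral V D g.
Proof.
move=> fg; rewrite /cmeasure_integral.
by congr ((_ - _) +i* (_ + _)); apply: eq_charge_integral => x xD;
  rewrite fg.
Qed.

Lemma cmeasure_integral_cst V D (c : R[i]) : measurable D ->
  cmeasure_integral V D (fun=> c) = c * cmeasure V D.
Proof.
move=> mD; rewrite /cmeasure_integral !charge_integral_cst//.
by case: c => a b; apply: complex_eq => /=; rewrite // addrC; ring.
Qed.

Lemma cmeasure_integralB V D f g : measurable D ->
  cbounded_measurable D f -> cbounded_measurable D g ->
  cmeasure_integral V D (fun x => f x - g x) =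
  cmeasure_integral V D f - cmeasure_integral V D g.
Proof.
move=> mD [fr fi] [gr gi]; rewrite /cmeasure_integral.
have -> : (fun x => complex.Re (f x - g x)) =
    (fun x => complex.Re (f x) - complex.Re (g x)).
  by apply/funext => x; rewrite ReD ReN.
have -> : (fun x => complex.Im (f x - g x)) =
    (fun x => complex.Im (f x) - complex.Im (g x)).
  by apply/funext => x; rewrite ImD ImN.
by rewrite !charge_integralB//; apply: complex_eq => /=; ring.
Qed.

Lemma cmeasure_integral_level_sets V D f (n : nat) (A : nat -> set T) :
  measurable D -> cbounded_measurable D f ->
  (forall k, measurable (A k)) -> trivIset setT A ->
  \big[setU/set0]_(k < n) A k = D ->
  cmeasure_integral V D f = \sum_(k < n) cmeasure_integral V (A k) f.
Proof.
move=> mD [fr fi] mA tA AD; rewrite /cmeasure_integral.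
rewrite !(charge_integral_level_sets _ mD _ mA tA AD)//.
rewrite -sumrB -big_split/=.
by apply: complex_eq; rewrite ?Re_sum ?Im_sum.
Qed.

Definition cmeasure_mass V D : R :=
  charge_mass (re_charge V) D + charge_mass (im_charge V) D.

(** The four real integrals are estimated one by one, so the constant is not sharp. This is harmless
    for a uniformly small [f], such as the error of an approximation. *)
Lemma cmeasure_integral_le V D f (e : R) : measurable D ->
  cmeasurable D f -> (forall x, D x -> cabs (f x) <= e) ->
  cabs (cmeasure_integral V D f) <= e * (2 * cmeasure_mass V D).
Proof.
move=> mD [mr mi] fe; rewrite (le_trans (cabs_le_ReIm _))//=.
have H nu : `|charge_integral nu D (fun x => complex.Re (f x))|
    <= e * charge_mass nu D.
  by apply: charge_integral_le => // x /fe; apply: le_trans; exact: Re_le_cabs.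
have K nu : `|charge_integral nu D (fun x => complex.Im (f x))|
    <= e * charge_mass nu D.
  by apply: charge_integral_le => // x /fe; apply: le_trans; exact: Im_le_cabs.
rewrite (le_trans (lerD (ler_normB _ _) (ler_normD _ _)))//.
rewrite (le_trans (lerD (lerD (H _) (K _)) (lerD (K _) (H _))))//.
by rewrite /cmeasure_mass le_eqVlt; apply/orP; left; apply/eqP; ring.
Qed.

End complex_measure_integral.

(** * Uniform approximation by functions with finitely many values *)

Section discretization.
Context d (T : measurableType d) (R : realType).
Implicit Types (D : set T) (f s : T -> R[i]).

(* The values c k are sampled from f (or 0), so that they obey the same bound
   as f. *)
Lemma cdiscretize D f (M e : R) : measurable D -> cmeasurable D f ->
  (forall x, D x -> cabs (f x) <= M) -> 0 <= M -> 0 < e ->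
  exists s (n : nat) (A : nat -> set T) (c : nat -> R[i]),
    [/\ forall k, measurable (A k), trivIset setT A,
        \big[setU/set0]_(k < n) A k = D,
        forall k, (n <= k)%N -> A k = set0 &
        [/\ cmeasurable D s, forall k x, A k x -> s x = c k,
        forall x, D x -> cabs (f x - s x) <= e &
        forall k, cabs (c k) <= M]].
Proof.
move=> mD [mr mi] fM M0 e0.
(* Real and imaginary parts are sorted into [m] half-open cells of side [h] starting at [- M]. Two
   points of the same square are then at distance at most [h + h = e]; the successor in [m] provides
   the cell that contains the endpoint [M]. *)
pose h := e / 2; have h0 : 0 < h by rewrite divr_gt0.
pose m := (Num.truncn (2 * M / h)).+1.
pose B p : set R := [set` `[p%:R * h - M, p.+1%:R * h - M[ ].
have BP p r : - M <= r -> B p r <-> Num.truncn ((r + M) / h) = p.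
  move=> Mr; have r0 : 0 <= (r + M) / h by rewrite divr_ge0 ?(ltW h0)//; lra.
  rewrite /B /= in_itv/= lerBlDr ltrBrDr -ler_pdivlMr// -ltr_pdivrMr//.
  split=> [/andP[pr rp]|<-].
    by apply/eqP; rewrite truncn_eq// pr rp.
  by have /andP[-> ->] := truncn_itv r0.
have Bm r : - M <= r <= M -> (Num.truncn ((r + M) / h) < m)%N.
  move=> /andP[Mr rM]; rewrite ltnS; apply: le_truncn.
  by rewrite ler_pM2r ?invr_gt0//; lra.
have reM x : D x -> - M <= complex.Re (f x) <= M.
  by move=> Dx; rewrite -ler_norml (le_trans (Re_le_cabs _))// fM.
have imM x : D x -> - M <= complex.Im (f x) <= M.
  by move=> Dx; rewrite -ler_norml (le_trans (Im_le_cabs _))// fM.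
(* The cell index [p] of the real part and [q] of the imaginary part are coded as [q * m + p] and
   recovered by division with remainder. *)
pose A k := if (k < m * m)%N then
  (D `&` (fun x => complex.Re (f x)) @^-1` B (k %% m)%N) `&`
  (D `&` (fun x => complex.Im (f x)) @^-1` B (k %/ m)%N) else set0.
have AE k x : (k < m * m)%N -> A k x -> [/\ D x,
    Num.truncn ((complex.Re (f x) + M) / h) = (k %% m)%N &
    Num.truncn ((complex.Im (f x) + M) / h) = (k %/ m)%N].
  move=> km; rewrite /A km => -[[Dx Bx] [_ Bx']]; split => //.
    by apply/BP => //; case/andP: (reM _ Dx).
  by apply/BP => //; case/andP: (imM _ Dx).
have AS k x : A k x -> (k < m * m)%N.
  by rewrite /A; case: ifP.
have mA k : measurable (A k).
  rewrite /A; case: ifP => // _; apply: measurableI.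
    by apply: mr => //; exact: measurable_itv.
  by apply: mi => //; exact: measurable_itv.
have tA : trivIset setT A.
  apply/trivIsetP => i j _ _; apply: contraNeq => /set0P[x [Ai Aj]].
  have [_ p1 q1] := AE _ _ (AS _ _ Ai) Ai.
  have [_ p2 q2] := AE _ _ (AS _ _ Aj) Aj.
  by rewrite (divn_eq i m) (divn_eq j m) -p1 -p2 -q1 -q2.
have UA : \big[setU/set0]_(k < m * m) A k = D.
  rewrite -bigcup_mkord; apply/seteqP; split => x.
    by move=> [k /= km /(AE _ _ km)[]].
  move=> Dx; pose p := Num.truncn ((complex.Re (f x) + M) / h).
  pose q := Num.truncn ((complex.Im (f x) + M) / h).
  have pm : (p < m)%N by exact/Bm/reM.
  have qm : (q < m)%N by exact/Bm/imM.
  have m0 : (0 < m)%N by [].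
  have km : (q * m + p < m * m)%N.
    rewrite (@leq_trans (q.+1 * m))//; last by rewrite leq_mul2r qm orbT.
    by rewrite mulSn addnC ltn_add2r.
  exists (q * m + p)%N => //=; rewrite /A km modnMDl (modn_small pm).
  rewrite divnMDl// (divn_small pm) addn0; split; split => //=; apply/BP => //.
    by case/andP: (reM _ Dx).
  by case/andP: (imM _ Dx).
pose c k :=
  if pselect (exists x, A k x) is left P then f (projT1 (cid P)) else 0.
pose s x := \sum_(k < m * m) (\1_(A k) x)%:C * c k.
have sc k x : A k x -> s x = c k.
  move=> Akx; have km := AS _ _ Akx.
  rewrite /s (bigD1 (Ordinal km))//= indicE mem_set// mul1r big1 ?addr0//.
  move=> i ik; rewrite indicE memNset ?mul0r// => Ai.
  have /trivIsetP/(_ i k I I ik) ik0 := tA.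
  by have : (A i `&` A k) x by []; rewrite ik0.
exists s, (m * m)%N, A, c; split => //.
- by move=> k mk; rewrite /A ltnNge mk.
- split => //.
  + split.
      rewrite /s; under eq_fun do rewrite Re_sum.
      apply: measurable_sum => k; under eq_fun do rewrite ReM/= mul0r subr0.
      by apply: measurable_funM => //; exact: measurable_indic.
    rewrite /s; under eq_fun do rewrite Im_sum.
    apply: measurable_sum => k; under eq_fun do rewrite ImM/= mul0r addr0.
    by apply: measurable_funM => //; exact: measurable_indic.
  + move=> x Dx; have : (\big[setU/set0]_(k < m * m) A k) x by rewrite UA.
    rewrite -bigcup_mkord => -[k /= km Akx]; rewrite (sc _ _ Akx) /c.
    case: pselect => [P|[]]; last by exists x.
    case: cid => y /= Aky.
    have [_ px qx] := AE _ _ km Akx; have [Dy py qy] := AE _ _ km Aky.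
    have close r r' p : - M <= r -> - M <= r' ->
        Num.truncn ((r + M) / h) = p -> Num.truncn ((r' + M) / h) = p ->
        `|r - r'| <= h.
      move=> Mr Mr' /(BP _ _ Mr) + /(BP _ _ Mr'); rewrite /B/= !in_itv/= -natr1.
      move=> /andP[? ?] /andP[? ?]; rewrite ler_norml; apply/andP; split; lra.
    rewrite (le_trans (cabs_le_ReIm _))// ReD ReN ImD ImN (splitr e).
    rewrite lerD//; [apply: close px py|apply: close qx qy].
    * by case/andP: (reM _ Dx).
    * by case/andP: (reM _ Dy).
    * by case/andP: (imM _ Dx).
    * by case/andP: (imM _ Dy).
  + move=> k; rewrite /c; case: pselect => [P|_]; last by rewrite cabs0.
    case: cid => y /= Aky; have [Dy _ _] := AE _ _ (AS _ _ Aky) Aky.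
    exact: fM.
Qed.

End discretization.

(** * Integrals of complex functions against a positive measure *)

Section complex_integral.
Context d (T : measurableType d) (R : realType).
Variables (mu : {measure set T -> \bar R}).
Implicit Types (D A : set T) (f g : T -> R[i]).

Lemma cmeasurable_cabs D f : cmeasurable D f ->
  measurable_fun D (fun x => cabs (f x)).
Proof.
move=> [mr mi].
have -> : (fun x => cabs (f x)) = (fun x =>
    Num.sqrt (complex.Re (f x) ^+ 2 + complex.Im (f x) ^+ 2)).
  by apply/funext => x; case: (f x).
apply: (@measurableT_comp _ _ _ _ _ _ (@Num.sqrt R)).
  by apply: continuous_measurable_fun; exact: sqrt_continuous.
by apply: measurable_funD; exact: measurable_funX.
Qed.

Lemma cintegrable_cmeasurable D f : cintegrable mu D f -> cmeasurable D f.
Proof.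
by move=> [/(measurable_int mu)/measurable_EFinP ?
  /(measurable_int mu)/measurable_EFinP].
Qed.

Lemma cintegrable_cabs D f : measurable D -> cintegrable mu D f ->
  mu.-integrable D (EFin \o (fun x => cabs (f x))).
Proof.
move=> mD intf; have [ir ii] := intf.
apply: (@le_integrable _ _ _ _ _ mD _ (EFin \o (fun x =>
    `|complex.Re (f x)| + `|complex.Im (f x)|))).
- exact/measurable_EFinP/cmeasurable_cabs/cintegrable_cmeasurable.
- move=> x Dx; rewrite lee_fin ger0_norm ?cabs_ge0//.
  by rewrite (le_trans _ (ler_norm _))// cabs_le_ReIm.
- have := integrableD mD (integrable_norm ir) (integrable_norm ii).
  by apply: eq_integrable => // x _ /=.
Qed.

Lemma cintegrableS D A f : measurable D -> measurable A -> A `<=` D ->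
  cintegrable mu D f -> cintegrable mu A f.
Proof. by move=> mD mA AD [ir ii]; split; exact: integrableS AD _. Qed.

Lemma cintegrableZ D (c : R[i]) f : measurable D -> cintegrable mu D f ->
  cintegrable mu D (fun x => c * f x).
Proof.
move=> mD [ir ii]; split.
  have := integrableB mD (integrableZl mD (complex.Re c) ir)
    (integrableZl mD (complex.Im c) ii).
  by apply: eq_integrable => // x _; rewrite /= ReM EFinB !EFinM.
have := integrableD mD (integrableZl mD (complex.Re c) ii)
  (integrableZl mD (complex.Im c) ir).
by apply: eq_integrable => // x _; rewrite /= ImM EFinD !EFinM.
Qed.

Lemma cintegrableD D f g : measurable D -> cintegrable mu D f ->
  cintegrable mu D g -> cintegrable mu D (fun x => f x + g x).
Proof.
move=> mD [fr fi] [gr gi]; split.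
  have := integrableD mD fr gr.
  by apply: eq_integrable => // x _; rewrite /= ReD EFinD.
have := integrableD mD fi gi.
by apply: eq_integrable => // x _; rewrite /= ImD EFinD.
Qed.

Lemma eq_cintegral D f g : {in D, f =1 g} ->
  cintegral mu D f = cintegral mu D g.
Proof.
by move=> fg; congr (_ +i* _); apply: eq_Rintegral => x xD; rewrite fg.
Qed.

Lemma cintegralD D f g : measurable D -> cintegrable mu D f ->
  cintegrable mu D g ->
  cintegral mu D (fun x => f x + g x) = cintegral mu D f + cintegral mu D g.
Proof.
move=> mD [fr fi] [gr gi]; apply: complex_eq; rewrite /= -RintegralD//;
  by apply: eq_Rintegral => x _; rewrite ?ReD ?ImD.
Qed.

Lemma cintegralZ D (c : R[i]) f : measurable D -> cintegrable mu D f ->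
  cintegral mu D (fun x => c * f x) = c * cintegral mu D f.
Proof.
move=> mD [ir ii]; apply: complex_eq; rewrite /= ?ReM ?ImM/=.
  rewrite -!RintegralZl// -RintegralB//.
  - by apply: eq_Rintegral => x _; rewrite ReM.
  - exact: (integrableZl mD (complex.Re c) ir).
  - exact: (integrableZl mD (complex.Im c) ii).
rewrite -!RintegralZl// -RintegralD//.
- by apply: eq_Rintegral => x _; rewrite ImM.
- exact: (integrableZl mD (complex.Re c) ii).
- exact: (integrableZl mD (complex.Im c) ir).
Qed.

(* With z the integral of f, |z|^2 is the integral of Re (conj z * f). *)
Lemma cabs_cintegral D f : measurable D -> cintegrable mu D f ->
  cabs (cintegral mu D f) <= \int[mu]_(x in D) cabs (f x).
Proof.
move=> mD intf; set z := cintegral mu D f.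
have [->|z0] := eqVneq (cabs z) 0.
  by apply: Rintegral_ge0 => x _; exact: cabs_ge0.
have zp : 0 < cabs z by rewrite lt_neqAle eq_sym z0 cabs_ge0.
rewrite -(ler_pM2l zp) -expr2 -RintegralZl//; last exact: cintegrable_cabs.
have -> : cabs z ^+ 2 = complex.Re (cintegral mu D (fun x => conjc z * f x)).
  rewrite cintegralZ// -/z cabs_sqr; case: (z) => a b /=.
  by rewrite mulNr opprK !expr2.
clearbody z; rewrite /=; apply: le_Rintegral => //.
- exact: (cintegrableZ _ _ _).1.
- exact: (integrableZl mD (cabs z) (cintegrable_cabs mD intf)).
- move=> x Dx; apply: le_trans (ler_norm _) _.
  by rewrite (le_trans (Re_le_cabs _))// cabsM cabs_conj.
Qed.

End complex_integral.

(** * The sharp bound of an integral by the total variation *)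

Section total_variation.
Context d (T : measurableType d) (R : realType).
Implicit Types (V : complex_measure T R) (D : set T) (f : T -> R[i]).

Lemma le_of_eps (x y K : R) : (forall e, 0 < e -> x <= y + e * K) -> x <= y.
Proof.
move=> H; apply/ler_addgt0Pr => e e0.
have K1 : 0 < 1 + `|K| by rewrite ltr_pwDl.
have := H (e / (1 + `|K|)) (divr_gt0 e0 K1); move/le_trans; apply.
rewrite lerD2l -mulrA ler_piMr ?(ltW e0)// mulrC ler_pdivrMr// mul1r.
by rewrite (le_trans (ler_norm _))// lerDr.
Qed.

(** For the approximation [s] with values [c k] on the cells [A k], the integral is the sum of
    [c k * cmeasure V (A k)]. As [cabs (c k) <= M], its modulus is at most [M] times a partial sum
    of a series in the supremum that defines the total variation. The integral of [f - s] costs [e]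
    times a constant independent of [e]. *)
Lemma cmeasure_integral_le_total_variation V D f (M tv : R) :
  measurable D -> cmeasurable D f -> (forall x, D x -> cabs (f x) <= M) ->
  0 <= M -> (complex_total_variation V D <= tv%:E)%E ->
  cabs (cmeasure_integral V D f) <= M * tv.
Proof.
move=> mD mf fM M0 Vtv; apply: (@le_of_eps _ _ (2 * cmeasure_mass V D)) => e e0.
have [s [n [A [c [mA tA UA A0 [ms sc fs cM]]]]]] := cdiscretize mD mf fM M0 e0.
have sM x : D x -> cabs (s x) <= M.
  by rewrite -UA -bigcup_mkord => -[k _ /sc ->]; exact: cM.
have bf := cbounded_measurable_bound mf fM.
have bs := cbounded_measurable_bound ms sM.
rewrite -[cmeasure_integral V D f](subrK (cmeasure_integral V D s)) addrC.
rewrite (le_trans (cabsD _ _))// lerD//; last first.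
  rewrite -cmeasure_integralB// cmeasure_integral_le//.
  split; [under eq_fun do rewrite ReD ReN|under eq_fun do rewrite ImD ImN].
    by apply: measurable_funB; [exact: mf.1|exact: ms.1].
  by apply: measurable_funB; [exact: mf.2|exact: ms.2].
rewrite (cmeasure_integral_level_sets _ mD bs mA tA UA).
rewrite (le_trans (cabs_sum _ _))//.
apply: (@le_trans _ _ (\sum_(k < n) M * cabs (cmeasure V (A k)))).
  apply: ler_sum => k _.
  rewrite (@eq_cmeasure_integral _ _ _ _ _ _ (fun=> c k)); last first.
    by move=> x /set_mem; exact: sc.
  by rewrite cmeasure_integral_cst// cabsM ler_wpM2r ?cabs_ge0.
rewrite -mulr_sumr ler_wpM2l// -lee_fin (le_trans _ Vtv)//.
(* The cells from index [n] on are empty, so the finite partition is also a countable one, as the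
   supremum asks for. *)
apply: le_trans (ereal_sup_ubound _); last first.
  exists A => //; split => //; rewrite -[RHS]UA -bigcup_mkord.
  apply/seteqP; split => x [k _ Akx]; last by exists k.
  have [kn|nk] := ltnP k n; first by exists k.
  by move: Akx; rewrite A0.
rewrite -sumEFin -(big_mkord xpredT (fun k => (cabs (cmeasure V (A k)))%:E)).
by apply: nneseries_lim_ge => k _; rewrite lee_fin cabs_ge0.
Qed.

End total_variation.

(** * Complex measures given by an integrable density *)

Section density.
Context d (T : measurableType d) (R : realType).
Variables (mu : {measure set T -> \bar R}) (D : set T) (mD : measurable D).

Lemma bounded_measurable_integrableM (u v : T -> R) :
  bounded_measurable D u -> mu.-integrable D (EFin \o v) ->
  mu.-integrable D (EFin \o (fun x => u x * v x)).
Proof.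
move=> [mu_ [N uN]] iv.
have := @integrableMr _ _ _ mu D mD u (EFin \o v) mu_.
move=> /(_ _ iv) => H; apply: H; exists N; split; first exact: num_real.
by move=> y Ny x Dx; apply: le_trans (uN _ Dx) _; exact: ltW.
Qed.

(** Both sides agree on functions that are constant on each cell of a finite partition, by the
    hypothesis on [nu]. A bounded [u] is a uniform limit of such functions, and both sides are
    continuous under uniform convergence. *)
Lemma charge_integral_density (nu : {charge set T -> \bar R}) (u v : T -> R) :
  mu.-integrable D (EFin \o v) ->
  (forall A, measurable A -> A `<=` D -> fine (nu A) = \int[mu]_(x in A) v x) ->
  bounded_measurable D u ->
  charge_integral nu D u = \int[mu]_(x in D) (u x * v x).
Proof.
move=> iv nuv bu; have [mu_ [M uM]] := bu.
apply/eqP; rewrite -subr_eq0 -normr_le0.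
(* Replacing [u] by its approximation [t] changes the left side by at most [e] times the first term
   and the right side by at most [e] times the second. *)
pose K := charge_mass nu D + \int[mu]_(x in D) `|v x|.
apply: (@le_of_eps _ _ _ K) => e e0; rewrite add0r.
have mf : cmeasurable D (fun x => (u x)%:C).
  by split => //=; exact: measurable_cst.
(* When [D] is empty the bound [M] may be negative, whereas [cdiscretize] asks for a nonnegative
   one. *)
have fM x : D x -> cabs (u x)%:C <= Num.max M 0.
  by move=> Dx; rewrite cabs_real le_max uM.
have M0 : 0 <= Num.max M 0 by rewrite le_max lexx orbT.
have [s [n [A [c [mA tA UA A0 [ms sc fs cM]]]]]] := cdiscretize mD mf fM M0 e0.
pose t x := complex.Re (s x).
have tM x : D x -> `|t x| <= Num.max M 0.
  rewrite -UA -bigcup_mkord => -[k _ /sc sk].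
  by rewrite (le_trans (Re_le_cabs _))// sk.
have mt : measurable_fun D t by exact: ms.1.
have bt : bounded_measurable D t by split => //; exists (Num.max M 0).
have ut x : D x -> `|u x - t x| <= e.
  move=> /fs; apply: le_trans; rewrite (le_trans _ (Re_le_cabs _))//.
  by rewrite ReD ReN.
have imul w (bw : bounded_measurable D w) :=
  bounded_measurable_integrableM bw iv.
have st : charge_integral nu D t = \int[mu]_(x in D) (t x * v x).
  rewrite (charge_integral_level_sets _ mD bt mA tA UA).
  rewrite (Rintegral_level_sets (imul _ bt) mD mA tA UA).
  apply: eq_bigr => k _.
  have AkD : A k `<=` D.
    by rewrite -UA -bigcup_mkord => x Akx; exists k => //=; exact: ltn_ord.
  rewrite (@eq_charge_integral _ _ _ _ _ _ (fun=> complex.Re (c k))).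
    2: by move=> x /set_mem /sc; rewrite /t => ->.
  rewrite charge_integral_cst// nuv// -RintegralZl//.
    2: exact: integrableS iv.
  by apply: eq_Rintegral => x /set_mem /sc; rewrite /t => ->.
rewrite -[charge_integral nu D u](subrK (charge_integral nu D t)) -addrA.
rewrite (le_trans (ler_normD _ _))// mulrDr lerD//.
  rewrite -charge_integralB// charge_integral_le//.
  exact: measurable_funB.
rewrite st -RintegralB//; [|exact: imul..].
have itu := imul _ (bounded_measurableB bt bu).
have -> : \int[mu]_(x in D) (t x * v x - u x * v x) =
    \int[mu]_(x in D) ((t x - u x) * v x).
  by apply: eq_Rintegral => x _; rewrite mulrBl.
rewrite (le_trans (le_normr_Rintegral mD itu))// -RintegralZl//; last first.
  exact: integrable_norm.
apply: le_Rintegral => //.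
- exact: integrable_norm.
- exact: (integrableZl mD e (integrable_norm iv)).
- by move=> x Dx; rewrite normrM distrC ler_wpM2r// ut.
Qed.

Variables (f : T -> R[i]) (intf : cintegrable mu D f).

Lemma re_density (A : set T) : A `<=` D ->
  fine (re_charge (density_measure mD intf) A) =
  \int[mu]_(x in A) complex.Re (f x).
Proof.
move=> AD; rewrite /density_measure/= /induced_charge /Rintegral; congr fine.
by apply: eq_integral => x /set_mem /AD Dx; rewrite patchE mem_set.
Qed.

Lemma im_density (A : set T) : A `<=` D ->
  fine (im_charge (density_measure mD intf) A) =
  \int[mu]_(x in A) complex.Im (f x).
Proof.
move=> AD; rewrite /density_measure/= /induced_charge /Rintegral; congr fine.
by apply: eq_integral => x /set_mem /AD Dx; rewrite patchE mem_set.
Qed.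

Lemma cmeasure_integral_density (g : T -> R[i]) : cbounded_measurable D g ->
  cmeasure_integral (density_measure mD intf) D g =
  cintegral mu D (fun x => f x * g x).
Proof.
move=> [gr gi]; have [ir ii] := intf.
have imul := bounded_measurable_integrableM.
rewrite /cmeasure_integral.
rewrite !(charge_integral_density ir (fun A _ AD => re_density AD))//.
rewrite !(charge_integral_density ii (fun A _ AD => im_density AD))//.
apply: complex_eq => /=.
  rewrite -RintegralB//; [|exact: imul..].
  by apply: eq_Rintegral => x _; rewrite ReM; ring.
rewrite -RintegralD//; [|exact: imul..].
by apply: eq_Rintegral => x _; rewrite ImM; ring.
Qed.

(** On each piece of a partition the modulus of the integral of [f] is at most the integral of
    [cabs (f x)], and the latter add up to the integral over [D] by countable additivity. *)
Lemma density_total_variation :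
  (complex_total_variation (density_measure mD intf) D <=
   (\int[mu]_(x in D) cabs (f x))%:E)%E.
Proof.
apply: ge_ereal_sup => _ [F [mF tF UF] <-].
have ic := cintegrable_cabs mD intf.
have -> : (\int[mu]_(x in D) cabs (f x))%:E =
    (\sum_(0 <= k <oo) (\int[mu]_(x in F k) cabs (f x))%:E)%E.
  rewrite /Rintegral fineK; last exact: integrable_fin_num.
  rewrite -[in LHS]UF ge0_integral_bigcup//; last 2 first.
    by rewrite UF; exact: measurable_int ic.
    by move=> x _; rewrite lee_fin cabs_ge0.
  apply: eq_eseriesr => k _; rewrite fineK//.
  apply: integrable_fin_num => //; apply: (integrableS mD (mF k) _ ic).
  by rewrite -UF => x Fx; exists k.
apply: lee_nneseries => [k _|k _]; first by rewrite lee_fin cabs_ge0.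
have FD : F k `<=` D by rewrite -UF => x Fx; exists k.
rewrite lee_fin /cmeasure re_density// im_density//.
by apply: cabs_cintegral => //; exact: cintegrableS intf.
Qed.

End density.

(** * Primitives in the integrated sense, and gluing at a point *)

Section primitives.
Context {R : realType}.
Local Notation leb := (@lebesgue_measure R).
Implicit Types (f g F G : R -> R) (s t c : R).

Lemma measurableR_itv (i : interval R) :
  measurable ([set` i] : set (measurableTypeR R)).
Proof. exact: measurable_itv. Qed.

(** The relation is expressed by integrals and not by derivatives, so that it survives gluing at a
    point where [F] has a corner and [f] a jump. *)
Definition rprimitive f F :=
  [/\ measurable_fun [set: measurableTypeR R] f,
      measurable_fun [set: measurableTypeR R] F &
      forall s t, s <= t -> leb.-integrable `]s, t[ (EFin \o f) /\
        \int[leb]_(x in `]s, t[) f x = F t - F s].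

Lemma rprimitive_derive f F : (forall x, is_derive (x : R) (1 : R) F (f x)) ->
  continuous f -> rprimitive f F.
Proof.
move=> dF cf.
have cF : continuous F.
  by move=> x; apply/differentiable_continuous/derivable1_diffP; case: (dF x).
split; [exact: continuous_measurable_fun..|move=> s t].
rewrite le_eqVlt => /predU1P[->|st].
  rewrite set_itvoo0 Rintegral_set0 subrr; split => //.
  exact: integrable_set0.
have iF : leb.-integrable `[s, t] (EFin \o f).
  apply: continuous_compact_integrable; first exact: segment_compact.
  exact: continuous_subspaceT.
have iFo : leb.-integrable `]s, t[ (EFin \o f).
  by apply: integrableS iF => //; exact: subset_itv_oo_cc.
have iFc : leb.-integrable `]s, t] (EFin \o f).
  by apply: integrableS iF => //; exact: subset_itv_oc_cc.
split => //.
rewrite Rintegral_itv_bndo_bndc// Rintegral_itv_obnd_cbnd// /Rintegral.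
rewrite (@continuous_FTC2 _ f F)//.
- exact: continuous_subspaceT.
- split.
  + by move=> x _; case: (dF x).
  + exact/cvg_at_right_filter/cF.
  + exact/cvg_at_left_filter/cF.
- by move=> x _; rewrite derive1E; case: (dF x).
Qed.

Lemma rprimitiveD f F g G : rprimitive f F -> rprimitive g G ->
  rprimitive (fun x => f x + g x) (fun x => F x + G x).
Proof.
move=> [mf mF Ff] [mg mG Gg]; split; [exact: measurable_funD..|move=> s t st].
have [iF eF] := Ff _ _ st; have [iG eG] := Gg _ _ st; split.
  have := integrableD (measurableR_itv _) iF iG.
  by apply: eq_integrable => // x _; rewrite /= EFinD.
by rewrite RintegralD// eF eG opprD addrACA.
Qed.

Lemma rprimitiveZ (r : R) f F : rprimitive f F ->
  rprimitive (fun x => r * f x) (fun x => r * F x).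
Proof.
move=> [mf mF Ff]; split.
- by apply: measurable_funM => //; exact: measurable_cst.
- by apply: measurable_funM => //; exact: measurable_cst.
move=> s t st.
have [iF eF] := Ff _ _ st; split.
  exact: (integrableZl (measurableR_itv _) r iF).
by rewrite RintegralZl// eF mulrBr.
Qed.

Definition glue (T : Type) c (f g : R -> T) x := if x < c then f x else g x.

Lemma measurable_glue c f g : measurable_fun [set: measurableTypeR R] f ->
  measurable_fun [set: measurableTypeR R] g ->
  measurable_fun [set: measurableTypeR R] (glue c f g).
Proof.
move=> mf mg; apply: measurable_fun_ifT => //.
by apply: measurable_fun_ltr => //; exact: measurable_cst.
Qed.

(** An interval on one side of [c] involves only one of the two pairs. An interval across [c] is cut
    there, and the boundary terms at [c] cancel because [F c = G c]. *)
Lemma rprimitive_glue c f F g G : rprimitive f F -> rprimitive g G ->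
  F c = G c -> rprimitive (glue c f g) (glue c F G).
Proof.
move=> [mf mF Ff] [mg mG Gg] FG; split; [exact: measurable_glue..|].
have lt_c s t : s <= t -> t <= c ->
    leb.-integrable `]s, t[ (EFin \o glue c f g) /\
    \int[leb]_(x in `]s, t[) glue c f g x = glue c F G t - glue c F G s.
  move=> st tc; have [iF eF] := Ff _ _ st.
  have E : {in `]s, t[%classic, f =1 glue c f g}.
    move=> x /set_mem/=; rewrite in_itv/= => /andP[_ xt].
    by rewrite /glue (lt_le_trans xt tc).
  split.
    by apply: eq_integrable iF => // x xst; rewrite /= E.
  transitivity (\int[leb]_(x in `]s, t[) f x).
    by apply: eq_Rintegral => x xst; rewrite E.
  rewrite eF /glue.
  case: (ltgtP t c) tc => // [tc _|tc _].
    by rewrite (le_lt_trans st tc).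
  case: (ltgtP s c) => [sc|cs|->]; last by rewrite tc !FG.
    by rewrite tc FG.
  by move: st; rewrite tc leNgt cs.
have ge_c s t : s <= t -> c <= s ->
    leb.-integrable `]s, t[ (EFin \o glue c f g) /\
    \int[leb]_(x in `]s, t[) glue c f g x = glue c F G t - glue c F G s.
  move=> st cs; have [iG eG] := Gg _ _ st.
  have E : {in `]s, t[%classic, g =1 glue c f g}.
    move=> x /set_mem/=; rewrite in_itv/= => /andP[sx _].
    by rewrite /glue ltNge (le_trans cs (ltW sx)).
  split.
    by apply: eq_integrable iG => // x xst; rewrite /= E.
  transitivity (\int[leb]_(x in `]s, t[) g x).
    by apply: eq_Rintegral => x xst; rewrite E.
  by rewrite eG /glue !ltNge cs (le_trans cs st).
move=> s t st.
have [tc|ct] := leP t c; first exact: lt_c.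
have [cs|sc] := leP c s; first exact: ge_c.
have [i1 e1] := lt_c _ _ (ltW sc) (lexx c).
have [i2 e2] := ge_c _ _ (ltW ct) (lexx c).
have ist : leb.-integrable `]s, t[ (EFin \o glue c f g).
  have [iF _] := Ff _ _ st; have [iG _] := Gg _ _ st.
  have := integrableD (measurableR_itv _) (integrable_norm iF)
    (integrable_norm iG).
  apply: le_integrable => //.
    by apply/measurable_EFinP/measurable_funTS; exact: measurable_glue.
  move=> x _; rewrite /= lee_fin [leRHS]ger0_norm ?addr_ge0// /glue.
  by case: ifP => _; rewrite ?lerDl ?lerDr.
split => //; rewrite (@itv_bndbnd_setU _ _ _ (BLeft c)) ?bnd_simp ?ltW//.
rewrite Rintegral_setU//.
- by rewrite e1 -Rintegral_itv_obnd_cbnd// e2; ring.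
- by rewrite -itv_bndbnd_setU ?bnd_simp ?ltW.
- rewrite disj_set2E; apply/eqP/seteqP; split => // x /=.
  rewrite !in_itv/= => -[/andP[_ xc] /andP[cx _]].
  by move: xc; rewrite ltNge cx.
Qed.

End primitives.

(** * The exponential with a complex rate, and primitives of complex functions *)

Section complex_exponential.
Context {R : realType}.
Implicit Types (z w : R[i]) (x y : R).

(** The function exp (z x) of a real variable [x], by Euler's formula. *)
Definition cexpx z x : R[i] :=
  (expR (complex.Re z * x) * cos (complex.Im z * x)) +i*
  (expR (complex.Re z * x) * sin (complex.Im z * x)).

Lemma cexpx0 z : cexpx z 0 = 1.
Proof. by rewrite /cexpx !mulr0 expR0 cos0 sin0 mulr0 mulr1. Qed.

Lemma cexpxD z w x : cexpx (z + w) x = cexpx z x * cexpx w x.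
Proof.
by apply: complex_eq;
  rewrite ?ReM ?ImM/= ReD ImD !mulrDl expRD ?cosD ?sinD; ring.
Qed.

Lemma cexpxN z x : cexpx z x * cexpx (- z) x = 1.
Proof.
rewrite -cexpxD subrr; apply: complex_eq; rewrite /= ?mul0r ?expR0.
  by rewrite cos0 mulr1.
by rewrite sin0 mulr0.
Qed.

Lemma cabs_cexpx z x : cabs (cexpx z x) = expR (complex.Re z * x).
Proof.
by rewrite /= !exprMn -mulrDr cos2Dsin2 mulr1 sqrtr_sqr ger0_norm.
Qed.

Lemma is_derive_scale (f : R -> R) (a df : R) x :
  is_derive (a * x : R) (1 : R) f df ->
  is_derive (x : R) (1 : R) (fun y => f (a * y)) (a * df).
Proof.
move=> dfx; have dm : is_derive (x : R) (1 : R) ( *%R a) a.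
  by apply: is_derive_eq; last by rewrite /GRing.scale/= mulr1.
by have := @is_derive1_comp _ f ( *%R a) x df a dfx dm; rewrite mulrC.
Qed.

Lemma is_derive_Re_cexpx z x : is_derive (x : R) (1 : R)
  (fun y => complex.Re (cexpx z y)) (complex.Re (z * cexpx z x)).
Proof.
have de := is_derive_scale (is_derive_expR (complex.Re z * x)).
have dc := is_derive_scale (is_derive_cos (complex.Im z * x)).
apply: (is_derive_eq (is_deriveM de dc)).
by rewrite ReM /GRing.scale/=; ring.
Qed.

Lemma is_derive_Im_cexpx z x : is_derive (x : R) (1 : R)
  (fun y => complex.Im (cexpx z y)) (complex.Im (z * cexpx z x)).
Proof.
have de := is_derive_scale (is_derive_expR (complex.Re z * x)).
have ds := is_derive_scale (is_derive_sin (complex.Im z * x)).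
apply: (is_derive_eq (is_deriveM de ds)).
by rewrite ImM /GRing.scale/=; ring.
Qed.

Lemma is_derive_continuous (f df : R -> R) :
  (forall x, is_derive (x : R) (1 : R) f (df x)) -> continuous f.
Proof.
move=> dF x; apply/differentiable_continuous/derivable1_diffP.
by case: (dF x).
Qed.

Definition cprimitive (f F : R -> R[i]) :=
  rprimitive (fun x => complex.Re (f x)) (fun x => complex.Re (F x)) /\
  rprimitive (fun x => complex.Im (f x)) (fun x => complex.Im (F x)).

Implicit Types (f F g G : R -> R[i]).

Lemma eq_cprimitive f F g G : f =1 g -> F =1 G ->
  cprimitive f F -> cprimitive g G.
Proof. by move=> /funext -> /funext ->. Qed.

Lemma cprimitiveD f F g G : cprimitive f F -> cprimitive g G ->
  cprimitive (fun x => f x + g x) (fun x => F x + G x).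
Proof.
move=> [fr fi] [gr gi]; split.
  have := rprimitiveD fr gr.
  by congr rprimitive; apply/funext => x; rewrite ReD.
have := rprimitiveD fi gi.
by congr rprimitive; apply/funext => x; rewrite ImD.
Qed.

Lemma cprimitiveZ (c : R[i]) f F : cprimitive f F ->
  cprimitive (fun x => c * f x) (fun x => c * F x).
Proof.
move=> [fr fi]; split.
  have := rprimitiveD (rprimitiveZ (complex.Re c) fr)
    (rprimitiveZ (- complex.Im c) fi).
  by congr rprimitive; apply/funext => x; rewrite ReM mulNr.
have := rprimitiveD (rprimitiveZ (complex.Re c) fi)
  (rprimitiveZ (complex.Im c) fr).
by congr rprimitive; apply/funext => x; rewrite ImM.
Qed.

Lemma cprimitive_glue c f F g G : cprimitive f F -> cprimitive g G ->
  F c = G c -> cprimitive (glue c f g) (glue c F G).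
Proof.
move=> [fr fi] [gr gi] FG; split.
  have := rprimitive_glue fr gr (congr1 (@complex.Re R) FG).
  by congr rprimitive; apply/funext => x; rewrite /glue; case: ifP.
have := rprimitive_glue fi gi (congr1 (@complex.Im R) FG).
by congr rprimitive; apply/funext => x; rewrite /glue; case: ifP.
Qed.

Lemma cprimitive_cst (c : R[i]) : cprimitive (fun=> 0) (fun=> c).
Proof.
have H (r : R) : rprimitive (fun=> 0) (fun=> r).
  by apply: rprimitive_derive => x; exact: cvg_cst.
by split; exact: H.
Qed.

Lemma cprimitive_real (f F : R -> R) : rprimitive f F ->
  cprimitive (fun x => (f x)%:C) (fun x => (F x)%:C).
Proof.
by move=> fF; split => //; exact: (cprimitive_cst 0).2.
Qed.

Lemma cprimitive_cexpx z : cprimitive (fun x => z * cexpx z x) (cexpx z).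
Proof.
have cr := is_derive_continuous (is_derive_Re_cexpx z).
have ci := is_derive_continuous (is_derive_Im_cexpx z).
split; apply: rprimitive_derive.
- exact: is_derive_Re_cexpx.
- move=> x; have -> : (fun x => complex.Re (z * cexpx z x)) = (fun x =>
      complex.Re z * complex.Re (cexpx z x)
      - complex.Im z * complex.Im (cexpx z x)).
    by apply/funext => y; rewrite ReM.
  apply: cvgB; (apply: cvgM; [exact: cvg_cst|]); [exact: cr|exact: ci].
- exact: is_derive_Im_cexpx.
- move=> x; have -> : (fun x => complex.Im (z * cexpx z x)) = (fun x =>
      complex.Re z * complex.Im (cexpx z x)
      + complex.Im z * complex.Re (cexpx z x)).
    by apply/funext => y; rewrite ImM.
  apply: cvgD; (apply: cvgM; [exact: cvg_cst|]); [exact: ci|exact: cr].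
Qed.

End complex_exponential.

(** * Integrals of exponentially decaying functions up to infinity *)

Section exponential_decay.
Context {R : realType}.
Local Notation leb := (@lebesgue_measure R).
Local Notation hl := (half_line R).
Implicit Types (a t : R).

Lemma integral_expRN a t : 0 < a ->
  (\int[leb]_(x in `[t, +oo[) (expR (- a * x))%:E = (expR (- a * t) / a)%:E)%E.
Proof.
move=> a0.
have df x : is_derive (x : R) (1 : R) (fun y => - a^-1 * expR (- a * y))
    (expR (- a * x)).
  have de := is_derive_scale (is_derive_expR (- a * x)).
  have dc := is_derive_cst (- a^-1) (x : R) (1 : R).
  apply: (is_derive_eq (is_deriveM dc de)).
  by rewrite /GRing.scale/= mulr0 addr0 mulrA mulrNN mulVf ?gt_eqF// mul1r.
have cF := is_derive_continuous df.
have cf : continuous (fun x : R => expR (- a * x)).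
  by apply: (@is_derive_continuous _ _ (fun x => - a * expR (- a * x))) => x;
    exact: (is_derive_scale (is_derive_expR (- a * x))).
rewrite (@ge0_continuous_FTC2y _ _ (fun y => - a^-1 * expR (- a * y)) _ 0).
- by rewrite -EFinB sub0r mulNr opprK mulrC.
- by move=> x _; exact: expR_ge0.
- exact: continuous_subspaceT.
- rewrite -(mulr0 (- a^-1)); apply: cvgM; first exact: cvg_cst.
  rewrite (_ : (fun x => expR (- a * x)) =
               (fun z => expR (- z)) \o (fun z => a * z)); last first.
    by apply/funext => x; rewrite /= mulNr.
  apply: (@cvg_comp _ _ _ _ _ _ (pinfty_nbhs R)); last exact: cvgr_expR.
  exact: gt0_cvgMry.
- by move=> x _; case: (df x).
- exact/cvg_at_right_filter/cF.
- by move=> x _; rewrite derive1E; case: (df x).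
Qed.

Lemma measurable_expR_scale a :
  measurable_fun [set: measurableTypeR R] (fun x : R => expR (a * x)).
Proof.
apply: continuous_measurable_fun.
by apply: (@is_derive_continuous _ _ (fun x => a * expR (a * x))) => x;
  exact: (is_derive_scale (is_derive_expR (a * x))).
Qed.

Lemma integrable_expRN a t (C : R) : 0 < a ->
  leb.-integrable `[t, +oo[ (EFin \o (fun x => C * expR (- a * x))).
Proof.
move=> a0.
suff H : leb.-integrable `[t, +oo[ (EFin \o (fun x => expR (- a * x))).
  exact: (integrableZl (measurableR_itv _) C H).
apply/integrableP; split.
  by apply/measurable_EFinP/measurable_funTS; exact: measurable_expR_scale.
under eq_integral do rewrite /= ger0_norm ?expR_ge0//.
by rewrite integral_expRN// ltry.
Qed.

Lemma subset_itv_oy_cy t :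
  `]t, +oo[%classic `<=` (`[t, +oo[%classic : set (measurableTypeR R)).
Proof. by move=> x /=; rewrite !in_itv/= !andbT; exact: ltW. Qed.

Definition rdecay a C (f : R -> R) :=
  forall x, 0 < x -> `|f x| <= C * expR (- a * x).

Lemma rdecay_integrable a C f (t : R) : 0 < a ->
  measurable_fun [set: measurableTypeR R] f -> rdecay a C f -> 0 <= t ->
  leb.-integrable `]t, +oo[ (EFin \o f).
Proof.
move=> a0 mf fC t0.
have H := integrableS (measurableR_itv _) (measurableR_itv _)
  (@subset_itv_oy_cy t) (integrable_expRN t C a0).
apply: le_integrable H => //.
  by apply/measurable_EFinP/measurable_funTS.
move=> x /=; rewrite in_itv/= andbT => tx; rewrite lee_fin.
by rewrite (le_trans (fC _ (le_lt_trans t0 tx)))// ler_norm.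
Qed.

(** Since [h] vanishes at infinity, [- h t] is its total increment beyond [t]. The integral is cut
    at a far point [N]: the part up to [N] is [h N - h t], and the rest is small. *)
Lemma rprimitive_tail a C (g h : R -> R) t : 0 < a -> rprimitive g h ->
  rdecay a C g -> rdecay a C h -> 0 < t ->
  \int[leb]_(x in `]t, +oo[) g x = - h t.
Proof.
move=> a0 [mg mh gh] gC hC t0.
have it s (s0 : 0 <= s) := rdecay_integrable a0 mg gC s0.
apply/eqP; rewrite -subr_eq0 opprK -normr_le0.
apply: (@le_of_eps _ _ _ (C / a + C)) => e e0; rewrite add0r.
have C0 : 0 <= C.
  have := le_trans (normr_ge0 _) (gC _ ltr01).
  by rewrite pmulr_lge0// expR_gt0.
(* This makes [expR (- a * N)] at most [e]. The tail of the integral beyond [N] then costs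
   [e * (C / a)], and the value [h N] costs [e * C]. *)
pose N := t + `|ln e| / a.
have tN : t <= N by rewrite lerDl divr_ge0// ltW.
have N0 : 0 < N by exact: lt_le_trans tN.
have Ne : expR (- a * N) <= e.
  rewrite -[leRHS]lnK ?posrE// ler_expR.
  have -> : - a * N = - (a * t) - `|ln e| by rewrite /N; field; rewrite gt_eqF.
  have := ler_norm (- ln e); rewrite normrN => ?.
  have := mulr_gt0 a0 t0 => ?; lra.
have -> : \int[leb]_(x in `]t, +oo[) g x = h N - h t
    + \int[leb]_(x in `]N, +oo[) g x.
  have [i1 e1] := gh _ _ tN.
  rewrite -e1 Rintegral_itv_bndo_bndc//.
  rewrite -(@Rintegral_itvB _ _ (BRight t) +oo%O N) ?bnd_simp//.
    by rewrite addrC subrK.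
  exact: it (ltW t0).
rewrite addrAC subrK addrC mulrDr (le_trans (ler_normD _ _))// lerD//.
  rewrite (le_trans (le_normr_Rintegral (measurableR_itv _) (it _ (ltW N0))))//.
  have iC := integrableS (measurableR_itv _) (measurableR_itv _)
    (@subset_itv_oy_cy N) (integrable_expRN N C a0).
  have iC' := integrable_expRN N C a0.
  apply: (@le_trans _ _ (\int[leb]_(x in `[N, +oo[) (C * expR (- a * x)))).
    rewrite -Rintegral_itv_obnd_cbnd//.
    apply: le_Rintegral => //; first exact: (integrable_norm (it _ (ltW N0))).
    move=> x /=; rewrite in_itv/= andbT => Nx; exact/gC/(lt_trans N0).
  rewrite RintegralZl//; last first.
    have := integrable_expRN N 1 a0; apply: eq_integrable => // x _.
    by rewrite /= mul1r.
  rewrite /Rintegral integral_expRN//= mulrCA ler_wpM2r//.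
  by rewrite divr_ge0// ltW.
by rewrite (le_trans (hC _ N0))// mulrC ler_wpM2r.
Qed.

End exponential_decay.

(** * Square-integrable functions and integration by parts *)

Section square_integrability.
Context {R : realType}.
Local Notation leb := (@lebesgue_measure R).
Local Notation hl := (half_line R).
Implicit Types (u v du g h : R -> R).

Definition rsquare_integrable u := measurable_fun hl u /\
  leb.-integrable hl (EFin \o (fun x => u x ^+ 2)).

Lemma rsquare_integrableM u v : rsquare_integrable u -> rsquare_integrable v ->
  leb.-integrable hl (EFin \o (fun x => u x * v x)).
Proof.
move=> [mu_ iu] [mv iv].
have H := integrableD (@measurable_half_line R) iu iv.
apply: le_integrable H => //.
- exact: measurable_half_line.
- by apply/measurable_EFinP/measurable_funM.
- move=> x _; rewrite lee_fin [leRHS]ger0_norm ?addr_ge0 ?sqr_ge0//.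
  rewrite normrM -[u x ^+ 2]real_normK ?num_real//.
  rewrite -[v x ^+ 2]real_normK ?num_real//.
  have := sqr_ge0 (`|u x| - `|v x|).
  have := mulr_ge0 (normr_ge0 (u x)) (normr_ge0 (v x)).
  rewrite sqrrB; lra.
Qed.

Lemma rdecay_square_integrable a C g : 0 < a ->
  measurable_fun [set: measurableTypeR R] g -> rdecay a C g ->
  rsquare_integrable g.
Proof.
move=> a0 mg gC; split; first exact: measurable_funTS.
apply: (@rdecay_integrable _ (a + a) (C ^+ 2)) => //.
- exact: addr_gt0.
- exact: measurable_funX.
- move=> x x0; rewrite normrX opprD mulrDl expRD -expr2 -exprMn.
  by rewrite lerXn2r ?nnegrE// ?gC// (le_trans _ (gC _ x0)).
Qed.

Lemma rsquare_integrable_itv u (x : R) : rsquare_integrable u -> 0 < x ->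
  leb.-integrable `]0, x[ (EFin \o u).
Proof.
move=> [mu_ iu] x0.
have sub : `]0, x[%classic `<=` hl.
  by move=> y; rewrite /half_line/= !in_itv/= andbT => /andP[].
have i1 : leb.-integrable `]0, x[ (EFin \o (cst 1 : R -> R)).
  apply: measurable_bounded_integrable => //.
    rewrite [X in (X < _)%E](lebesgue_measure_itv `]0, x[)/= lte_fin x0.
    by rewrite -EFinB ltry.
  by exists 1; split; [exact: num_real|move=> y y1 z _ /=; rewrite normr1 ltW].
have i2 := integrableS (@measurable_half_line R) (measurableR_itv _) sub iu.
have H := integrableD (measurableR_itv _) i1 i2.
apply: le_integrable H => //.
- apply/measurable_EFinP.
  exact: (measurable_funS (@measurable_half_line R) sub mu_).
- move=> y _; rewrite lee_fin [leRHS]ger0_norm ?addr_ge0 ?sqr_ge0//.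
  rewrite -[u y ^+ 2]real_normK ?num_real//.
  have := sqr_ge0 (`|u y| - 1); have := normr_ge0 (u y).
  rewrite sqrrB expr1n /=; lra.
Qed.

(** Inserting the representation of [u] turns the left side into the integral of [du t * g x] over
    the triangle 0 < t < x. By Fubini the integration in [x] may come first, and the integral of [g]
    beyond [t] is [- h t]. There are no boundary terms, because the representation of [u] starts at
    0 and [h] decays. *)
Lemma Rintegral_parts a C u du g h : 0 < a -> rsquare_integrable du ->
  rsquare_integrable u ->
  (forall x, 0 < x -> u x = \int[leb]_(t in `]0, x[) du t) ->
  rprimitive g h -> rdecay a C g -> rdecay a C h ->
  \int[leb]_(x in hl) (u x * g x) = - \int[leb]_(t in hl) (du t * h t).
Proof.
move=> a0 sdu su udu gh gC hC; have [mg mh _] := gh.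
have [mdu _] := sdu.
have sg := rdecay_square_integrable a0 mg gC.
have sh := rdecay_square_integrable a0 mh hC.
have mhl := @measurable_half_line R.
(* Extension by 0 allows Fubini on the whole plane: together with the test [p.2 < p.1] it cuts out
   the triangle. *)
pose du0 := du \_ hl.
have out t : ~ t \in hl -> t <= 0.
  move=> thl; rewrite leNgt; apply/negP => t0; apply: thl.
  by rewrite inE /half_line/= in_itv/= t0.
have du0E t : 0 < t -> du0 t = du t.
  by move=> t0; rewrite /du0 patchE mem_set//= /half_line/= in_itv/= andbT.
have du00 t : t <= 0 -> du0 t = 0.
  move=> t0; rewrite /du0 patchE memNset//= /half_line/= in_itv/= andbT.
  by rewrite ltNge t0.
pose f (p : measurableTypeR R * measurableTypeR R) : \bar R :=
  (du0 p.2 * (if p.2 < p.1 then g p.1 else 0))%:E.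
have mdu0 : measurable_fun [set: measurableTypeR R] du0.
  by apply/(measurable_restrictT _ mhl).
have mf : measurable_fun setT f.
  apply/measurable_EFinP; apply: measurable_funM.
    exact: (measurableT_comp mdu0 measurable_snd).
  apply: measurable_fun_ifT.
  - by apply: measurable_fun_ltr; [exact: measurable_snd|exact: measurable_fst].
  - exact: (measurableT_comp mg measurable_fst).
  - exact: measurable_cst.
have tail_int t k : 0 <= t -> measurable_fun [set: measurableTypeR R] k ->
    rdecay a C k -> leb.-integrable `]t, +oo[ (EFin \o k).
  by move=> t0 mk kC; exact: rdecay_integrable kC _.
have inner1 x : (\int[leb]_t f (x, t) = ((fun x => (u x * g x)%:E) \_ hl) x)%E.
  rewrite patchE; case: ifPn => [/set_mem|/negP xhl].
    rewrite /half_line/= in_itv/= andbT => x0.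
    rewrite (_ : (fun t => f (x, t)) = (fun t => (du t * g x)%:E) \_ `]0, x[).
      rewrite -integral_mkcond udu// -RintegralZr//; last first.
        exact: rsquare_integrable_itv.
      rewrite /Rintegral fineK//; apply: integrable_fin_num => //.
      have := integrableZr (measurableR_itv _) (g x)
        (rsquare_integrable_itv sdu x0).
      exact: eq_integrable.
    apply/funext => t; rewrite patchE; case: ifPn => [/set_mem/=|/negP tx].
      by rewrite in_itv/= => /andP[t0 tx]; rewrite /f/= tx du0E.
    rewrite /f/=; case: ifPn => [lt_tx|_]; last by rewrite mulr0.
    have [t0|t0] := leP t 0; first by rewrite du00// mul0r.
    by case: tx; rewrite inE/= in_itv/= t0.
  have x0 : x <= 0.
    exact: out xhl.
  apply: integral0_eq => t _; rewrite /f/=; case: ifPn => [tx|_].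
    by rewrite du00 ?mul0r// (le_trans (ltW tx)).
  by rewrite mulr0.
have slice t : 0 < t ->
    (fun x => f (x, t)) = (fun x => (du t * g x)%:E) \_ `]t, +oo[.
  move=> t0; apply/funext => x; rewrite patchE.
  case: ifPn => [/set_mem/=|/negP tx]; rewrite /f/= du0E//.
    by rewrite in_itv/= andbT => ->.
  case: ifPn => [lt_tx|_]; last by rewrite mulr0.
  by case: tx; rewrite inE/= in_itv/= lt_tx.
have slice0 t x : t <= 0 -> f (x, t) = 0%E.
  by move=> t0; rewrite /f/= du00// mul0r.
have inner2 t :
    (\int[leb]_x f (x, t) = ((fun t => (- (du t * h t))%:E) \_ hl) t)%E.
  rewrite patchE; case: ifPn => [/set_mem|/negP thl].
    rewrite /half_line/= in_itv/= andbT => t0.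
    rewrite slice// -integral_mkcond -mulrN -(rprimitive_tail a0 gh gC hC t0).
    have itg := tail_int _ _ (ltW t0) mg gC.
    rewrite -RintegralZl// /Rintegral fineK//; apply: integrable_fin_num => //.
    exact: (integrableZl (measurableR_itv _) (du t) itg).
  have t0 : t <= 0.
    exact: out thl.
  by apply: integral0_eq => x _; exact: slice0.
have intf : (leb \x leb)%E.-integrable setT f.
  apply/integrable21ltyP => //.
  (* The integral of [|g|] beyond [t] is at most [C / a * expR (- a * t)], so [B] dominates the
     inner integrals of [|f|]. It is integrable as a product of two square-integrable functions. *)
  pose B := (fun t => (`|du t| * (C / a * expR (- a * t)))%:E) \_ hl.
  have iB : leb.-integrable hl
      (fun t => (`|du t| * (C / a * expR (- a * t)))%:E).
    apply: rsquare_integrableM.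
      split; first exact: measurableT_comp.
      have [_] := sdu; apply: eq_integrable => // x _.
      by rewrite /= real_normK ?num_real.
    apply: (@rdecay_square_integrable a `|C / a|) => //.
      apply: measurable_funM; first exact: measurable_cst.
      exact: measurable_expR_scale.
    by move=> x _; rewrite normrM (ger0_norm (expR_ge0 _)).
  apply: (@le_lt_trans _ _ (\int[leb]_t B t)%E); last first.
    by rewrite /B -integral_mkcond; exact: integrable_lty iB.
  apply: ge0_le_integral => //.
  - by move=> t _; apply: integral_ge0 => x _; exact: abse_ge0.
  - apply: (measurable_fun_fubini_tonelli_G (abse \o f)) => //=.
    exact: measurableT_comp.
  - by apply/(measurable_restrictT _ mhl); exact: measurable_int iB.
  move=> t _; rewrite /B patchE; case: ifPn => [/set_mem|/negP thl]; last first.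
    have t0 : t <= 0.
      exact: out thl.
    by rewrite integral0_eq// => x _; rewrite slice0// abse0.
  rewrite /half_line/= in_itv/= andbT => t0.
  have -> : (fun x => `|f (x, t)|)%E =
      (fun x => (`|du t| * `|g x|)%:E) \_ `]t, +oo[.
    apply/funext => x.
    have -> : f (x, t) = ((fun x => (du t * g x)%:E) \_ `]t, +oo[) x.
      by rewrite -slice.
    by rewrite !patchE; case: ifPn => _; rewrite ?abse0//= normrM.
  rewrite -integral_mkcond.
  have itg := tail_int _ _ (ltW t0) mg gC.
  under eq_integral do rewrite EFinM.
  rewrite ge0_integralZl//; last first.
    by apply/measurable_EFinP/measurable_funTS/measurableT_comp.
  rewrite EFinM lee_wpmul2l ?lee_fin//.
  have mexp (D : set (measurableTypeR R)) :
      measurable_fun D (fun x => C * expR (- a * x)).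
    apply: measurable_funM; first exact: measurable_cst.
    by apply: measurable_funTS; exact: measurable_expR_scale.
  apply: (@le_trans _ _
    (\int[leb]_(x in `[t, +oo[) (C * expR (- a * x))%:E)%E).
    rewrite -integral_itv_obnd_cbnd; last first.
      by apply/measurable_EFinP; exact: mexp.
    apply: ge0_le_integral => //.
    - by apply/measurable_EFinP/measurable_funTS/measurableT_comp.
    - by apply/measurable_EFinP; exact: mexp.
    - move=> x /=; rewrite in_itv/= andbT => tx.
      by rewrite lee_fin gC// (lt_trans t0).
  under eq_integral do rewrite EFinM.
  have C0 : 0 <= C.
    have := le_trans (normr_ge0 _) (gC _ ltr01).
    by rewrite pmulr_lge0// expR_gt0.
  rewrite ge0_integralZl//.
  - by rewrite integral_expRN// -EFinM lee_fin -mulrA [_^-1 * _]mulrC.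
  - by apply/measurable_EFinP/measurable_funTS; exact: measurable_expR_scale.
have := Fubini intf.
under eq_integral do rewrite inner1.
under [in RHS]eq_integral do rewrite inner2.
rewrite -!integral_mkcond => E.
have idh := rsquare_integrableM sdu sh.
rewrite -mulN1r -RintegralZl// /Rintegral E; congr fine.
by apply: eq_integral => x _; rewrite mulN1r.
Qed.

End square_integrability.

(** * The space H^1_0: integration by parts and boundedness *)

Section H10_theory.
Context {R : realType}.
Local Notation leb := (@lebesgue_measure R).
Local Notation hl := (half_line R).
Implicit Types (f g h psi dpsi : measurableTypeR R -> R[i]).

Lemma square_integrableP f : square_integrable leb hl f <->
  rsquare_integrable (fun x => complex.Re (f x)) /\
  rsquare_integrable (fun x => complex.Im (f x)).
Proof.
have mhl := @measurable_half_line R.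
split=> [[[mr mi] sf]|[[mr ir] [mi ii]]].
  split; (split; first by []); apply: (le_integrable mhl _ _ sf).
  - by apply/measurable_EFinP; exact: measurable_funX.
  - by move=> x _; rewrite lee_fin !ger0_norm ?sqr_ge0// cabs_sqr lerDl sqr_ge0.
  - by apply/measurable_EFinP; exact: measurable_funX.
  - by move=> x _; rewrite lee_fin !ger0_norm ?sqr_ge0// cabs_sqr lerDr sqr_ge0.
split=> //; have := integrableD mhl ir ii.
by apply: eq_integrable => // x _; rewrite /= cabs_sqr EFinD.
Qed.

Lemma square_integrableM f g : square_integrable leb hl f ->
  square_integrable leb hl g -> cintegrable leb hl (fun x => f x * g x).
Proof.
have mhl := @measurable_half_line R.
move=> /square_integrableP[fr fi] /square_integrableP[gr gi]; split.
  have := integrableB mhl (rsquare_integrableM fr gr)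
    (rsquare_integrableM fi gi).
  by apply: eq_integrable => // x _; rewrite /= ReM EFinB.
have := integrableD mhl (rsquare_integrableM fr gi) (rsquare_integrableM fi gr).
by apply: eq_integrable => // x _; rewrite /= ImM EFinD.
Qed.

Lemma square_integrable_conj f : square_integrable leb hl f ->
  square_integrable leb hl (fun x => conjc (f x)).
Proof.
have mhl := @measurable_half_line R.
move=> [[mr mi] sf]; split; last first.
  by apply: eq_integrable sf => // x _; rewrite /= cabs_conj.
split.
  by apply: eq_measurable_fun mr => x _; case: (f x).
have := measurable_funN mi.
by apply: eq_measurable_fun => x _ /=; case: (f x).
Qed.

Definition cdecay (a C : R) f :=
  forall x, 0 < x -> cabs (f x) <= C * expR (- a * x).

Lemma cdecay_Re a C f : cdecay a C f -> rdecay a C (fun x => complex.Re (f x)).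
Proof. by move=> fC x /fC; apply: le_trans; exact: Re_le_cabs. Qed.

Lemma cdecay_Im a C f : cdecay a C f -> rdecay a C (fun x => complex.Im (f x)).
Proof. by move=> fC x /fC; apply: le_trans; exact: Im_le_cabs. Qed.

Lemma cdecay_le a C C' f : C <= C' -> cdecay a C f -> cdecay a C' f.
Proof.
by move=> CC fC x /fC/le_trans; apply; rewrite ler_wpM2r ?expR_ge0.
Qed.

Lemma cdecay_square_integrable a C f : 0 < a ->
  measurable_fun [set: measurableTypeR R] (fun x => complex.Re (f x)) ->
  measurable_fun [set: measurableTypeR R] (fun x => complex.Im (f x)) ->
  cdecay a C f -> square_integrable leb hl f.
Proof.
move=> a0 mr mi fC; apply/square_integrableP; split.
  exact: rdecay_square_integrable mr (cdecay_Re fC).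
exact: rdecay_square_integrable mi (cdecay_Im fC).
Qed.

Lemma cprimitive_square_integrable a C g h : 0 < a -> cprimitive g h ->
  cdecay a C g -> square_integrable leb hl g.
Proof. by move=> a0 [[mr _ _] [mi _ _]]; exact: cdecay_square_integrable. Qed.

Lemma cprimitive_square_integrable_prim a C g h : 0 < a -> cprimitive g h ->
  cdecay a C h -> square_integrable leb hl h.
Proof. by move=> a0 [[_ mr _] [_ mi _]]; exact: cdecay_square_integrable. Qed.

Lemma cprimitive_cintegral g h s t : cprimitive g h -> s <= t ->
  cintegral leb `]s, t[ g = h t - h s.
Proof.
move=> [[_ _ gr] [_ _ gi]] st.
have [_ er] := gr _ _ st; have [_ ei] := gi _ _ st.
by rewrite /cintegral er ei; apply: complex_eq; rewrite /= ?ReD ?ReN ?ImD ?ImN.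
Qed.

Lemma cprimitive_H10 a C dpsi psi : 0 < a -> cprimitive dpsi psi ->
  psi 0 = 0 -> cdecay a C psi -> cdecay a C dpsi -> H10 psi dpsi.
Proof.
move=> a0 dp p0 pC dC; split.
- exact: cprimitive_square_integrable_prim dp pC.
- exact: cprimitive_square_integrable dp dC.
- by move=> x x0; rewrite (cprimitive_cintegral dp (ltW x0)) p0 subr0.
Qed.

Lemma H10_conj psi dpsi : H10 psi dpsi ->
  H10 (fun x => conjc (psi x)) (fun x => conjc (dpsi x)).
Proof.
move=> [sp sd pd]; split; [exact: square_integrable_conj..|].
have /square_integrableP[sr si] := sd.
move=> x x0; rewrite pd//; apply: complex_eq => /=.
  by apply: eq_Rintegral => y _; case: (dpsi y).
rewrite -mulN1r -RintegralZl//; last exact: rsquare_integrable_itv si x0.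
by apply: eq_Rintegral => y _; rewrite mulN1r; case: (dpsi y).
Qed.

Lemma cintegral_parts a C psi dpsi g h : 0 < a -> H10 psi dpsi ->
  cprimitive g h -> cdecay a C g -> cdecay a C h ->
  cintegral leb hl (fun x => psi x * g x) =
  - cintegral leb hl (fun x => dpsi x * h x).
Proof.
move=> a0 [sp sd pd] gh gC hC; have [ghr ghi] := gh.
have mhl := @measurable_half_line R.
have /square_integrableP[pr pi] := sp; have /square_integrableP[dr di] := sd.
have /square_integrableP[gr gi] := cprimitive_square_integrable a0 gh gC.
have /square_integrableP[hr hi] := cprimitive_square_integrable_prim a0 gh hC.
have pdr (x : R) : 0 < x -> complex.Re (psi x) =
    \int[leb]_(t in `]0, x[) complex.Re (dpsi t) by move=> /pd ->.
have pdi (x : R) : 0 < x -> complex.Im (psi x) =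
    \int[leb]_(t in `]0, x[) complex.Im (dpsi t) by move=> /pd ->.
have parts := Rintegral_parts a0.
apply: complex_eq; rewrite ?ReN ?ImN /=.
  have -> : \int[leb]_(x in hl) complex.Re (psi x * g x) =
      \int[leb]_(x in hl) (complex.Re (psi x) * complex.Re (g x))
      - \int[leb]_(x in hl) (complex.Im (psi x) * complex.Im (g x)).
    rewrite -RintegralB//; [|exact: rsquare_integrableM..].
    by apply: eq_Rintegral => x _; rewrite ReM.
  rewrite (parts _ _ _ _ _ dr pr pdr ghr (cdecay_Re gC) (cdecay_Re hC)).
  rewrite (parts _ _ _ _ _ di pi pdi ghi (cdecay_Im gC) (cdecay_Im hC)).
  rewrite -opprD -RintegralB//; [|exact: rsquare_integrableM..].
  by congr (- _); apply: eq_Rintegral => x _; rewrite ReM.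
have -> : \int[leb]_(x in hl) complex.Im (psi x * g x) =
    \int[leb]_(x in hl) (complex.Re (psi x) * complex.Im (g x))
    + \int[leb]_(x in hl) (complex.Im (psi x) * complex.Re (g x)).
  rewrite -RintegralD//; [|exact: rsquare_integrableM..].
  by apply: eq_Rintegral => x _; rewrite ImM.
rewrite (parts _ _ _ _ _ dr pr pdr ghi (cdecay_Im gC) (cdecay_Im hC)).
rewrite (parts _ _ _ _ _ di pi pdi ghr (cdecay_Re gC) (cdecay_Re hC)).
rewrite -opprD -RintegralD//; [|exact: rsquare_integrableM..].
by congr (- _); apply: eq_Rintegral => x _; rewrite ImM.
Qed.

(* On a unit interval ]x, x + 1[ the function u varies by at most
   1 + \int u'^2, and the mean of u^2 is at most \int u^2. *)
Lemma rsquare_integrable_bounded (u du : R -> R) : rsquare_integrable u ->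
  rsquare_integrable du ->
  (forall x, 0 < x -> u x = \int[leb]_(t in `]0, x[) du t) ->
  exists M, forall x, 0 < x -> `|u x| <= M.
Proof.
move=> su sd ud; have mhl := @measurable_half_line R.
have [mu_ iu] := su; have [md id] := sd.
pose N := \int[leb]_(t in hl) (u t ^+ 2).
pose K := 1 + \int[leb]_(t in hl) (du t ^+ 2).
(* This is the average over [y] in []x, x + 1[] of the inequality u(x)^2 <= 2 u(y)^2 + 2 (u(y) -
   u(x))^2, whose defect is the square of 2 u(y) - u(x). *)
exists (Num.sqrt (2 * N + 2 * K ^+ 2)) => x x0.
rewrite -sqrtr_sqr ler_sqrt//; last first.
  rewrite addr_ge0// mulr_ge0// ?sqr_ge0//.
  by apply: Rintegral_ge0 => t _; exact: sqr_ge0.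
have sub s t : 0 <= s -> `]s, t[%classic `<=` hl.
  move=> s0 y; rewrite /half_line/= !in_itv/= andbT => /andP[sy _].
  exact: le_lt_trans sy.
have len (s t : R) : s < t -> leb (`]s, t[%classic : set R) = (t - s)%:E.
  by move=> st; rewrite lebesgue_measure_itv/= lte_fin st -EFinB.
have icst (s t r : R) : leb.-integrable `]s, t[ (EFin \o (fun=> r)).
  apply: measurable_bounded_integrable => //.
    have [st|ts] := ltP s t; first by rewrite [X in (X < _)%E]len// ltry.
    by rewrite set_itv_ge ?bnd_simp -?leNgt// measure0.
  by exists `|r|; split; [exact: num_real|move=> y ry z _ /=; exact: ltW].
have x10 : 0 < x + 1 by rewrite addr_gt0.
have close y : `]x, (x + 1)%R[%classic y -> `|u y - u x| <= K.
  rewrite /= in_itv/= => /andP[xy yx1]; have y0 := lt_trans x0 xy.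
  have iy := rsquare_integrable_itv sd y0.
  have ix := rsquare_integrable_itv sd x0.
  rewrite (ud _ x0) Rintegral_itv_bndo_bndc// (ud _ y0).
  rewrite Rintegral_itvB//= ?bnd_simp ?(ltW x0) ?(ltW xy)//.
  have subxy := sub x y (ltW x0).
  have ixy : leb.-integrable `]x, y[ (EFin \o du).
    by apply: integrableS iy => //; apply: subset_itvr; rewrite bnd_simp ltW.
  rewrite (le_trans (le_normr_Rintegral (measurableR_itv _) ixy))//.
  have isq := integrableS mhl (measurableR_itv _) subxy id.
  apply: (@le_trans _ _ (\int[leb]_(t in `]x, y[) (1 + du t ^+ 2))).
    apply: le_Rintegral => //.
    - exact: integrable_norm.
    - have := integrableD (measurableR_itv _) (icst x y 1) isq.
      by apply: eq_integrable.
    - move=> t _; rewrite -[du t ^+ 2]real_normK ?num_real//.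
      have := sqr_ge0 (`|du t| - 1); have := normr_ge0 (du t).
      rewrite sqrrB expr1n; lra.
  rewrite RintegralD// /K lerD//.
    by rewrite Rintegral_cst// mul1r [X in fine X]len//=; lra.
  rewrite /Rintegral fine_le//; try exact: integrable_fin_num.
  apply: ge0_subset_integral => //.
  - by case/integrableP: id.
  - by move=> t _; rewrite lee_fin sqr_ge0.
have iu1 := integrableS mhl (measurableR_itv _) (sub x (x + 1) (ltW x0)) iu.
have -> : u x ^+ 2 = \int[leb]_(y in `]x, (x + 1)%R[) (u x ^+ 2).
  rewrite Rintegral_cst// [X in fine X]len ?ltrDl//=.
  by rewrite [x + 1]addrC addrK mulr1.
apply: (@le_trans _ _
    (\int[leb]_(y in `]x, (x + 1)%R[) (2 * u y ^+ 2 + 2 * K ^+ 2))).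
  apply: le_Rintegral => //.
    have := integrableD (measurableR_itv _)
      (integrableZl (measurableR_itv _) 2 iu1) (icst x (x + 1) (2 * K ^+ 2)).
    by apply: eq_integrable.
  move=> y /close; rewrite -(@ler_pXn2r _ 2)// ?nnegrE//; last first.
    by rewrite addr_ge0//; apply: Rintegral_ge0 => t _; exact: sqr_ge0.
  rewrite real_normK ?num_real// => H.
  by have := sqr_ge0 (2 * u y - u x); move: H; lra.
rewrite RintegralD//; last first.
  exact: (integrableZl (measurableR_itv _) 2 iu1).
rewrite lerD//.
  rewrite RintegralZl// ler_wpM2l// /Rintegral fine_le//;
    try exact: integrable_fin_num.
  apply: ge0_subset_integral => //.
  - by case/integrableP: iu.
  - by move=> t _; rewrite lee_fin sqr_ge0.
  - by apply: sub; exact: ltW.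
rewrite Rintegral_cst// [X in fine X]len ?ltrDl//=.
by rewrite [x + 1]addrC addrK mulr1.
Qed.

Lemma H10_bounded psi dpsi : H10 psi dpsi ->
  exists2 M, 0 <= M & forall x, 0 < x -> cabs (psi x) <= M.
Proof.
move=> [/square_integrableP[pr pi] /square_integrableP[dr di] pd].
have [x x0|Mr Mrp] := rsquare_integrable_bounded pr dr; first by rewrite pd.
have [x x0|Mi Mip] := rsquare_integrable_bounded pi di; first by rewrite pd.
exists (Mr + Mi).
  rewrite addr_ge0//.
    exact: le_trans (normr_ge0 _) (Mrp _ ltr01).
  exact: le_trans (normr_ge0 _) (Mip _ ltr01).
by move=> x x0; rewrite (le_trans (cabs_le_ReIm _))// lerD ?Mrp ?Mip.
Qed.

End H10_theory.

(** * Growth bounds with unspecified constants *)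

Section dominated_functions.
Context {R : realType}.
Implicit Types (P : R -> Prop) (w : R -> R) (f g : R -> R[i]) (k : R[i]).

(** With the constant hidden, the property is closed under linear combinations, so the decay of
    glued exponentials and polynomials is obtained without computing constants. *)
Definition dominated P w f := exists C, forall x, P x -> cabs (f x) <= C * w x.

Lemma dominatedD P w f g : dominated P w f -> dominated P w g ->
  dominated P w (fun x => f x + g x).
Proof.
move=> [C fC] [D gD]; exists (C + D) => x Px.
by rewrite (le_trans (cabsD _ _))// mulrDl lerD ?fC ?gD.
Qed.

Lemma dominatedZ P w c f : dominated P w f -> dominated P w (fun x => c * f x).
Proof.
move=> [C fC]; exists (cabs c * C) => x Px.
by rewrite cabsM -mulrA ler_wpM2l ?cabs_ge0 ?fC.
Qed.

Lemma dominated_cst (a b : R) c :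
  dominated (fun x => a < x /\ x < b) (fun=> 1) (fun=> c).
Proof. by exists (cabs c) => x _; rewrite mulr1. Qed.

Lemma dominated_cexpx (b : R) k :
  dominated (fun x => 0 < x /\ x < b) (fun=> 1) (cexpx k).
Proof.
exists (expR (`|complex.Re k| * b)) => x [x0 xb]; rewrite mulr1 cabs_cexpx.
rewrite ler_expR (le_trans (ler_norm _))// normrM (gtr0_norm x0).
by rewrite ler_wpM2l// ltW.
Qed.

Lemma dominated_cexpxN (b : R) k :
  dominated (fun x => 0 < x /\ b <= x) (fun x => expR (- complex.Re k * x))
    (cexpx (- k)).
Proof. by exists 1 => x _; rewrite cabs_cexpx ReN mul1r. Qed.

Lemma dominated_glue_cst P (c : R) f g : dominated P (fun=> 1) f ->
  dominated P (fun=> 1) g -> dominated P (fun=> 1) (glue c f g).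
Proof.
move=> [C fC] [D gD]; exists (Num.max C D) => x Px; rewrite mulr1 /glue.
by case: ifP => _; rewrite le_max; apply/orP; [left|right];
  rewrite -[leRHS]mulr1 ?fC ?gD.
Qed.

(** To the left of [c] a bounded function is also bounded by a multiple of [expR (- a * x)], at the
    price of a factor [expR (a * c)]. *)
Lemma dominated_glue (a c : R) f g : 0 < a ->
  dominated (fun x => 0 < x /\ x < c) (fun=> 1) f ->
  dominated (fun x => 0 < x /\ c <= x) (fun x => expR (- a * x)) g ->
  exists C, cdecay a C (glue c f g).
Proof.
move=> a0 [C fC] [D gD]; exists (`|C| * expR (a * c) + `|D|) => x x0.
rewrite /glue mulrDl; case: ltP => [xc|cx].
  rewrite (le_trans (fC _ (conj x0 xc)))// mulr1 -mulrA -expRD.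
  rewrite (le_trans (ler_norm _))//.
  rewrite (@le_trans _ _ (`|C| * expR (a * c + - a * x)))//.
    by rewrite ler_peMr// -expR0 ler_expR mulNr subr_ge0 ler_wpM2l// ltW.
  by rewrite lerDl mulr_ge0 ?expR_ge0.
rewrite (le_trans (gD _ (conj x0 cx)))//.
rewrite (@le_trans _ _ (`|D| * expR (- a * x)))//.
  by rewrite ler_wpM2r ?expR_ge0// ler_norm.
by rewrite lerDr !mulr_ge0 ?expR_ge0.
Qed.

End dominated_functions.

(** * The Dirichlet Green function and its reproducing property *)

Section green_function.
Context {R : realType}.
Local Notation leb := (@lebesgue_measure R).
Local Notation hl := (half_line R).
Variables (k : R[i]) (y : R).
Hypotheses (k0 : 0 < complex.Re k) (y0 : 0 < y).

Let kN0 : k != 0.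
Proof. by apply: contraTneq k0 => ->; rewrite ltxx. Qed.

Let two0 : (2 : R[i]) != 0.
Proof. by rewrite pnatr_eq0. Qed.

Let expNe : cexpx (- k) y = (cexpx k y)^-1.
Proof.
have e0 : cexpx k y != 0.
  by rewrite -cabs_eq0 cabs_cexpx gt_eqF// expR_gt0.
by apply: (mulfI e0); rewrite cexpxN divff.
Qed.

Let e0 : cexpx k y != 0.
Proof. by rewrite -cabs_eq0 cabs_cexpx gt_eqF// expR_gt0. Qed.

(** The branches are [G1] = exp (-k y) sinh (k x) / k and [G2] = sinh (k y) exp (-k x) / k. They and
    their derivatives are written as sums of scalar multiples, the shape to which [cprimitiveD] and
    [cprimitiveZ] apply. *)
Let c1 : R[i] := cexpx (- k) y / (2 * k).
Let c2 : R[i] := (cexpx k y - cexpx (- k) y) / (2 * k).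

Let G1 x := c1 * (cexpx k x + -1 * cexpx (- k) x).
Let dG1 x := c1 * (k * cexpx k x + -1 * (- k * cexpx (- k) x)).
Let ddG1 x := c1 * (k * (k * cexpx k x) + -1 * (- k * (- k * cexpx (- k) x))).
Let G2 x := c2 * cexpx (- k) x.
Let dG2 x := c2 * (- k * cexpx (- k) x).
Let ddG2 x := c2 * (- k * (- k * cexpx (- k) x)).

(* The Dirichlet Green function (exp (-k |x-y|) - exp (-k (x+y))) / 2k. *)
Definition green : R -> R[i] := glue y G1 G2.
Definition dgreen : R -> R[i] := glue y dG1 dG2.

Let pG1 : cprimitive dG1 G1.
Proof.
apply/cprimitiveZ/cprimitiveD; first exact: cprimitive_cexpx.
exact/cprimitiveZ/cprimitive_cexpx.
Qed.

Let pdG1 : cprimitive ddG1 dG1.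
Proof.
apply/cprimitiveZ/cprimitiveD; first exact/cprimitiveZ/cprimitive_cexpx.
exact/cprimitiveZ/cprimitiveZ/cprimitive_cexpx.
Qed.

Let pG2 : cprimitive dG2 G2.
Proof. exact/cprimitiveZ/cprimitive_cexpx. Qed.

Let pdG2 : cprimitive ddG2 dG2.
Proof. exact/cprimitiveZ/cprimitiveZ/cprimitive_cexpx. Qed.

Lemma green_cprimitive : cprimitive dgreen green.
Proof.
apply: cprimitive_glue => //.
by rewrite /G1 /G2 /c1 /c2 expNe; field; rewrite ?e0 ?kN0 ?two0.
Qed.

(** This is - G'' + k^2 G = delta_y without distributions: the derivative of G drops by 1 at [y],
    and subtracting the indicator of [x < y] closes the gap, so that the two pieces can be glued. *)
Lemma dgreen_jump_cprimitive :
  cprimitive (fun x => k ^+ 2 * green x) (fun x => dgreen x - (x < y)%R%:R).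
Proof.
have p1 := cprimitiveD pdG1 (cprimitive_cst (-1)).
have : cprimitive (glue y (fun x => ddG1 x + 0) ddG2)
    (glue y (fun x => dG1 x + -1) dG2).
  apply: cprimitive_glue => //.
  by rewrite /dG1 /dG2 /c1 /c2 expNe; field; rewrite ?e0 ?kN0 ?two0.
apply: eq_cprimitive => x; rewrite /green /dgreen /glue; case: ifP => _.
- by rewrite /ddG1 /G1; ring.
- by rewrite /ddG2 /G2; ring.
- by [].
- by rewrite subr0.
Qed.

Lemma green0 : green 0 = 0.
Proof. by rewrite /green /glue y0 /G1 !cexpx0; ring. Qed.

Lemma green_decay : exists C, cdecay (complex.Re k) C green.
Proof.
apply: dominated_glue => //.
  apply/dominatedZ/dominatedD; first exact: dominated_cexpx.
  exact/dominatedZ/dominated_cexpx.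
exact/dominatedZ/dominated_cexpxN.
Qed.

Lemma dgreen_decay : exists C, cdecay (complex.Re k) C dgreen.
Proof.
apply: dominated_glue => //.
  apply/dominatedZ/dominatedD; first exact/dominatedZ/dominated_cexpx.
  exact/dominatedZ/dominatedZ/dominated_cexpx.
exact/dominatedZ/dominatedZ/dominated_cexpxN.
Qed.

Lemma dgreen_jump_decay :
  exists C, cdecay (complex.Re k) C (fun x => dgreen x - (x < y)%R%:R).
Proof.
have -> : (fun x => dgreen x - (x < y)%R%:R) =
    glue y (fun x => dG1 x + -1) dG2.
  by apply/funext => x; rewrite /dgreen /glue; case: ifP => _; rewrite ?subr0.
apply: dominated_glue => //.
  apply: dominatedD; last exact: dominated_cst.
  apply/dominatedZ/dominatedD; first exact/dominatedZ/dominated_cexpx.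
  exact/dominatedZ/dominatedZ/dominated_cexpx.
exact/dominatedZ/dominatedZ/dominated_cexpxN.
Qed.

Lemma green_H10 : H10 green dgreen.
Proof.
have [C1 d1] := green_decay; have [C2 d2] := dgreen_decay.
apply: (@cprimitive_H10 _ _ (Num.max C1 C2) _ _ k0 green_cprimitive green0).
  by apply: cdecay_le d1; rewrite le_max lexx.
by apply: cdecay_le d2; rewrite le_max lexx orbT.
Qed.

(** The decaying factor carries the larger of [x] and [y], and the difference of exponentials the
    smaller one. After multiplication both exponentials have modulus at most 1, which gives 2 / (2
    |k|). *)
Lemma cabs_green_le (x : R) : 0 < x -> cabs (green x) <= (cabs k)^-1.
Proof.
move=> x0; have n0 : 0 < cabs k.
  by rewrite lt_neqAle eq_sym cabs_eq0 kN0 cabs_ge0.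
have n2 : cabs (2 * k) = 2 * cabs k.
  by rewrite cabsM -[2 in LHS](rmorph_nat (real_complex R)) cabs_real normr_nat.
have small s t : 0 < s -> s <= t ->
    expR (- complex.Re k * t) *
    (expR (complex.Re k * s) + expR (- complex.Re k * s)) <= 2.
  move=> s0 st; rewrite mulrDr -!expRD.
  have h1 : expR (- complex.Re k * t + complex.Re k * s) <= 1.
    by rewrite -expR0 ler_expR mulNr addrC subr_le0 ler_wpM2l// ltW.
  have h2 : expR (- complex.Re k * t + - complex.Re k * s) <= 1.
    rewrite -expR0 ler_expR -mulrDr mulNr oppr_le0 mulr_ge0// ?ltW//.
    by rewrite addr_gt0// (lt_le_trans s0).
  lra.
have fin u : u <= 2 -> u / (2 * cabs k) <= (cabs k)^-1.
  move=> u2; rewrite invfM mulrA ler_piMl ?invr_ge0 ?(ltW n0)//.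
  by rewrite ler_pdivrMr// mul1r.
rewrite /green /glue; case: ltP => [xy|yx].
  rewrite /G1 /c1 !cabsM cabsV n2 mulrAC fin// cabs_cexpx ReN.
  apply: le_trans (small x y x0 (ltW xy)); rewrite ler_wpM2l ?expR_ge0//.
  by rewrite (le_trans (cabsD _ _))// mulN1r cabsN !cabs_cexpx ReN.
rewrite /G2 /c2 !cabsM cabsV n2 mulrAC fin// cabs_cexpx ReN mulrC.
apply: le_trans (small y x y0 yx); rewrite ler_wpM2l ?expR_ge0//.
by rewrite (le_trans (cabsD _ _))// cabsN !cabs_cexpx ReN.
Qed.

(** Integration by parts of [psi] against [k ^+ 2 * green], with the primitive [dgreen] minus an
    indicator: the indicator contributes the integral of [dpsi] over []0, y[], which is [psi y]. *)
Lemma green_reproducing psi dpsi : H10 psi dpsi ->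
  cintegral leb hl (fun x => dpsi x * dgreen x)
  + k ^+ 2 * cintegral leb hl (fun x => psi x * green x) = psi y.
Proof.
move=> Hp; have [sp sd pd] := Hp; have mhl := @measurable_half_line R.
have [sg sdg _] := green_H10.
have [C1 d1] := green_decay; have [C2 d2] := dgreen_jump_decay.
pose C := Num.max (cabs (k ^+ 2) * C1) C2.
have dG : cdecay (complex.Re k) C (fun x => k ^+ 2 * green x).
  apply: (@cdecay_le _ _ (cabs (k ^+ 2) * C1)); first by rewrite le_max lexx.
  by move=> x x0; rewrite cabsM -mulrA ler_wpM2l ?cabs_ge0 ?d1.
have dJ : cdecay (complex.Re k) C (fun x => dgreen x - (x < y)%R%:R).
  by apply: cdecay_le d2; rewrite le_max lexx orbT.
have parts := cintegral_parts k0 Hp dgreen_jump_cprimitive dG dJ.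
have i1 := square_integrableM sd sdg.
have i2 := square_integrableM sp sg.
have ir := square_integrableM sd (cprimitive_square_integrable_prim k0
  dgreen_jump_cprimitive dJ).
have ij : cintegrable leb hl (fun x => dpsi x * (x < y)%R%:R).
  have := cintegrableD mhl i1 (cintegrableZ (-1) mhl ir).
  by congr cintegrable; apply/funext => x; ring.
have jump : cintegral leb hl (fun x => dpsi x * (x < y)%R%:R) = psi y.
  have hly : hl `&` `]0, y[%classic = `]0, y[%classic.
    apply/seteqP; split => x; first by case.
    move=> xy; split => //; move: xy.
    by rewrite /half_line/= !in_itv/= andbT => /andP[].
  rewrite pd// /cintegral -[in RHS]hly !Rintegral_mkcondr.
  apply: complex_eq => /=; apply: eq_Rintegral => x /set_mem;
    rewrite /half_line/= in_itv/= andbT => x0; rewrite patchE;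
    case: ifPn => [/set_mem/=|/negP xy].
  - by rewrite in_itv/= => /andP[_ ->]; rewrite mulr1.
  - rewrite (_ : (x < y) = false) ?mulr0//; apply/negP => lxy; apply: xy.
    by rewrite inE/= in_itv/= x0.
  - by rewrite in_itv/= => /andP[_ ->]; rewrite mulr1.
  - rewrite (_ : (x < y) = false) ?mulr0//; apply/negP => lxy; apply: xy.
    by rewrite inE/= in_itv/= x0.
have E1 : cintegral leb hl (fun x => psi x * (k ^+ 2 * green x)) =
    k ^+ 2 * cintegral leb hl (fun x => psi x * green x).
  by rewrite -cintegralZ//; apply: eq_cintegral => x _; ring.
have E2 : cintegral leb hl (fun x => dpsi x * (dgreen x - (x < y)%R%:R)) =
    cintegral leb hl (fun x => dpsi x * dgreen x) - psi y.
  rewrite -jump -mulN1r -cintegralZ// -cintegralD//; last exact: cintegrableZ.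
  by apply: eq_cintegral => x _; ring.
by move: parts; rewrite E1 E2 => ->; ring.
Qed.

End green_function.

(** * The bound on eigenvalues *)

Section eigenvalue_bound.
Context {R : realType}.
Local Notation leb := (@lebesgue_measure R).
Local Notation hl := (half_line R).
Implicit Types (V : potential R) (lambda k : R[i]).

(** One of the two square roots of [- lambda] has positive real part unless both are purely
    imaginary, and in that case [lambda] is the square of a real number. *)
Lemma off_half_axis_root lambda : off_half_axis lambda ->
  exists2 k : R[i], k ^+ 2 = - lambda & 0 < complex.Re k.
Proof.
move=> ol; have s2 := sqr_sqrtc (- lambda); set s := sqrtc _ in s2.
have [sn|sp|s0] := ltgtP (complex.Re s) 0; last 1 first.
- exfalso; move/negP : ol; apply; rewrite -[lambda]opprK -s2.
  move: s0; case: (s) => a b /= ->; rewrite expr2.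
  by rewrite lecE/=; apply/andP; split; [apply/eqP; ring|nra].
- by exists (- s); rewrite ?sqrrN// ReN oppr_gt0.
- by exists s.
Qed.

Lemma cmeasurableM (D : set (measurableTypeR R))
    (f g : measurableTypeR R -> R[i]) :
  cmeasurable D f -> cmeasurable D g -> cmeasurable D (fun x => f x * g x).
Proof.
move=> [fr fi] [gr gi]; split.
  under eq_fun do rewrite ReM.
  by apply: measurable_funB; exact: measurable_funM.
under eq_fun do rewrite ImM.
by apply: measurable_funD; exact: measurable_funM.
Qed.

Lemma schrodinger_green V lambda k psi (y : R) : k ^+ 2 = - lambda ->
  0 < complex.Re k -> schrodinger_operator V psi (fun x => lambda * psi x) ->
  0 < y -> psi y = cmeasure_integral V hl (fun x => psi x * green k y x).
Proof.
move=> kl k0 [_ [dpsi Hp weak]] y0; have mhl := @measurable_half_line R.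
have Hg := green_H10 k0 y0.
have [sp sd _] := Hp; have [sg sdg _] := Hg.
have conjK (f : measurableTypeR R -> R[i]) x : conjc (conjc (f x)) = f x.
  exact: conjcK.
(* The form conjugates its second argument, while [green_reproducing] is a bilinear identity; the
   conjugate test function reconciles the two. *)
have := weak _ _ (H10_conj Hg); rewrite /schrodinger_form /L2_inner.
under [X in cintegral _ _ X - _]eq_fun do rewrite conjK.
under [X in _ - cmeasure_integral _ _ X]eq_fun do rewrite conjK.
under [X in _ = cintegral _ _ X]eq_fun do rewrite conjK -mulrA.
rewrite cintegralZ//; last exact: square_integrableM.
have := green_reproducing k0 y0 Hp; rewrite kl => <- /eqP.
by rewrite subr_eq => /eqP ->; ring.
Qed.

(** An arbitrary real upper bound [tv] takes the place of the total variation, so that the same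
    argument covers measures and, with [tv] the L^1 norm, densities. *)
Lemma eigenvalue_bound V lambda (tv : R) : off_half_axis lambda ->
  schrodinger_eigenvalue V lambda ->
  (complex_total_variation V hl <= tv%:E)%E ->
  Num.sqrt (cabs lambda) <= tv.
Proof.
move=> /off_half_axis_root[k kl k0] [psi pne op] tvV.
have mhl := @measurable_half_line R.
have -> : Num.sqrt (cabs lambda) = cabs k.
  rewrite -[lambda]opprK -kl cabsN expr2 cabsM -expr2 sqrtr_sqr.
  by rewrite ger0_norm ?cabs_ge0.
have n0 : 0 < cabs k.
  rewrite lt_neqAle eq_sym cabs_eq0 cabs_ge0 andbT.
  by apply: contraTneq k0 => ->; rewrite ltxx.
rewrite leNgt; apply/negP => tvk; apply: pne.
have [_ [dpsi Hp _]] := op; have [M _ pM] := H10_bounded Hp.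
pose S := sup [set cabs (psi x) | x in hl].
have hS : has_sup [set cabs (psi x) | x in hl].
  split.
    by exists (cabs (psi 1)), 1 => //; rewrite /half_line/= in_itv/= ltr01.
  by exists M => _ [x + <-]; rewrite /half_line/= in_itv/= andbT => /pM.
have pS x : 0 < x -> cabs (psi x) <= S.
  move=> x0; apply: sup_upper_bound => //; exists x => //.
  by rewrite /half_line/= in_itv/= x0.
have S0 : 0 <= S by exact: le_trans (cabs_ge0 _) (pS _ ltr01).
have Sr : S <= S / cabs k * tv.
  apply: ge_sup; first by case: hS.
  move=> _ [y + <-]; rewrite /half_line/= in_itv/= andbT => y0.
  rewrite (schrodinger_green kl k0 op y0).
  apply: cmeasure_integral_le_total_variation => //.
  - have [[mp _] _ _] := Hp; have [[mg _] _ _] := green_H10 k0 y0.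
    exact: cmeasurableM.
  - move=> x; rewrite /half_line/= in_itv/= andbT => x0.
    by rewrite cabsM ler_pM ?cabs_ge0 ?pS ?cabs_green_le.
  - by rewrite divr_ge0 ?cabs_ge0.
have S00 : S = 0.
  apply/eqP; rewrite eq_le S0 andbT leNgt; apply/negP => Sp.
  move: Sr; rewrite leNgt => /negP; apply.
  by rewrite mulrAC -mulrA gtr_pMr// ltr_pdivrMr// mul1r.
apply: aeW => x; rewrite /half_line/= in_itv/= andbT => x0.
by apply/eqP; rewrite -cabs_eq0 eq_le cabs_ge0 andbT -S00 pS.
Qed.

Lemma eigenvalue_bound_total_variation V lambda : off_half_axis lambda ->
  schrodinger_eigenvalue V lambda ->
  ((Num.sqrt (cabs lambda))%:E <= complex_total_variation V hl)%E.
Proof.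
move=> ol ev; have := eigenvalue_bound ol ev.
case: (complex_total_variation V hl) => [r|_|H].
- by move=> H; rewrite lee_fin; exact: H.
- by rewrite leey.
(* The value -oo cannot occur: [tv = -1] would then be admissible and bound a square root from
   above. *)
- have := H (-1) (leNye _); rewrite leNgt => /negP[].
  by rewrite (lt_le_trans _ (sqrtr_ge0 _))// ltrN10.
Qed.

Lemma eigenvalue_bound_L1_norm (V : measurableTypeR R -> R[i])
  (intV : cintegrable leb hl V) lambda : off_half_axis lambda ->
  schrodinger_eigenvalue (function_potential intV) lambda ->
  Num.sqrt (cabs lambda) <= L1_norm V.
Proof.
move=> ol ev; apply: (eigenvalue_bound ol ev).
exact: density_total_variation.
Qed.

End eigenvalue_bound.

(** * From pointwise solutions to eigenfunctions *)

Section explicit_eigenvalue.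
Context {R : realType}.
Local Notation leb := (@lebesgue_measure R).
Local Notation hl := (half_line R).

(** The derivative is moved from the test function, of which only membership in [H10] is known, onto
    [dpsi]; the explicit functions provide the decay that [cintegral_parts] asks for. The
    differential equation then holds under the integral. *)
Lemma explicit_eigenvalue (a C : R) (k : R[i])
    (psi dpsi ddpsi V : measurableTypeR R -> R[i])
    (intV : cintegrable leb hl V) :
  0 < a -> cprimitive dpsi psi -> cprimitive ddpsi dpsi -> psi 0 = 0 ->
  cdecay a C psi -> cdecay a C dpsi -> cdecay a C ddpsi ->
  (forall x, 0 < x -> ddpsi x = k ^+ 2 * psi x - V x * psi x) ->
  ~ {ae leb, forall x, hl x -> psi x = 0} ->
  schrodinger_eigenvalue (function_potential intV) (- k ^+ 2).
Proof.
move=> a0 pd dd p0 dC0 dC1 dC2 ode pne; have mhl := @measurable_half_line R.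
have Hp := cprimitive_H10 a0 pd p0 dC0 dC1; have [sp sd _] := Hp.
exists psi => //; split.
  have := cprimitive_square_integrable_prim a0 (cprimitiveZ (- k ^+ 2) pd).
  apply => x x0; rewrite cabsM.
  by apply: (le_trans (ler_wpM2l (cabs_ge0 _) (dC0 _ x0))); rewrite mulrA.
exists dpsi => // phi dphi Hf; rewrite /schrodinger_form /L2_inner.
have Hc := H10_conj Hf; have [sf sdf _] := Hc.
have sdd := cprimitive_square_integrable a0 dd dC2.
have parts := cintegral_parts a0 Hc dd dC2 dC1.
have [M1 M10 b1] := H10_bounded Hp; have [M2 M20 b2] := H10_bounded Hf.
rewrite cmeasure_integral_density; last first.
  apply: (@cbounded_measurable_bound _ _ _ _ _ (M1 * M2)).
    by apply: cmeasurableM; [exact: sp.1|exact: sf.1].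
  move=> x; rewrite /half_line/= in_itv/= andbT => x0.
  by rewrite cabsM cabs_conj ler_pM ?cabs_ge0 ?b1 ?b2.
have ipf := square_integrableM sp sf; have iddf := square_integrableM sf sdd.
have -> : cintegral leb hl (fun x => dpsi x * conjc (dphi x)) =
    - cintegral leb hl (fun x => conjc (phi x) * ddpsi x).
  by rewrite parts opprK; apply: eq_cintegral => x _; rewrite mulrC.
have -> : cintegral leb hl (fun x => V x * (psi x * conjc (phi x))) =
    k ^+ 2 * cintegral leb hl (fun x => psi x * conjc (phi x))
    - cintegral leb hl (fun x => conjc (phi x) * ddpsi x).
  rewrite -mulN1r -!cintegralZ// -cintegralD//; [|exact: cintegrableZ..].
  apply: eq_cintegral => x /set_mem; rewrite /half_line/= in_itv/= andbT => x0.
  by rewrite ode//; ring.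
rewrite [RHS](_ : _ =
  - k ^+ 2 * cintegral leb hl (fun x => psi x * conjc (phi x))).
  by ring.
by rewrite -cintegralZ//; apply: eq_cintegral => x _; rewrite mulrA.
Qed.

End explicit_eigenvalue.

(** * Potentials for which the bound is nearly attained *)

Section sharpness.
Context {R : realType}.
Local Notation leb := (@lebesgue_measure R).
Local Notation hl := (half_line R).
Variable e : R.
Hypotheses (e0 : 0 < e) (e1 : e <= 100^-1).

Let k : R[i] := e +i* (pi / 2).
Let A : R := expR e.
Let B : R := expR (- e).
(* tanh e *)
Let tau : R := (A - B) / (A + B).
(** Normalizes the arc [p1] to the value 1 at 1, because exp k - exp (-k) = i (A + B) when Im k = pi
    / 2. *)
Let al : R[i] := (0 +i* (A + B))^-1.
(* With this value the parabola p2 leaves 1 + e with logarithmic derivative - k,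
   as does the decaying exponential p3. *)
Let q : R[i] := - (k * (1 + tau%:C + k * tau%:C * e%:C)) /
  (e%:C * (1 + k * e%:C / 2)).

Let A0 : 0 < A. Proof. exact: expR_gt0. Qed.
Let B0 : 0 < B. Proof. exact: expR_gt0. Qed.
Let AB : A * B = 1. Proof. by rewrite -expRD subrr expR0. Qed.
Let e1' : e <= 1. Proof. by rewrite (le_trans e1)// invf_le1// ler1n. Qed.

Let B1 : 1 - e <= B. Proof. by have := expR_ge1Dx (- e). Qed.

Let tau0 : 0 <= tau.
Proof.
apply: divr_ge0; last by rewrite addr_ge0 ?(ltW A0) ?(ltW B0).
by rewrite subr_ge0 ler_expR; move: e0; lra.
Qed.

Let tau_le : tau <= 2 * e.
Proof.
rewrite ler_pdivrMr ?addr_gt0//.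
have h1 : 1 - 2 * e <= B ^+ 2.
  have : (1 - e) ^+ 2 <= B ^+ 2.
    by rewrite ler_pXn2r ?nnegrE ?subr_ge0// (ltW B0).
  have := sqr_ge0 e; rewrite sqrrB expr1n; lra.
have h2 : A - B <= A * (2 * e).
  have -> : B = A * B ^+ 2 by rewrite expr2 mulrA AB mul1r.
  rewrite -[X in X - _]mulr1 -mulrBr ler_wpM2l ?(ltW A0)//; lra.
rewrite (le_trans h2)// mulrC ler_wpM2l ?lerDl ?(ltW B0)//.
by rewrite mulr_ge0// ltW.
Qed.

Let kN0 : k != 0.
Proof. by rewrite eq_complex /= gt_eqF. Qed.

Let n := cabs k.

Let n0 : 0 < n.
Proof. by rewrite lt_neqAle eq_sym cabs_eq0 kN0 cabs_ge0. Qed.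

Let n3 : n <= 3.
Proof.
rewrite (le_trans (cabs_le_ReIm _))//=.
have /andP[p0 p2] := @pihalf_02 R; rewrite !gtr0_norm//.
by move: e1' p2; lra.
Qed.

Let cexp1 : cexpx k 1 = 0 +i* A.
Proof.
by rewrite /cexpx /= !mulr1 cos_pihalf sin_pihalf mulr0 mulr1.
Qed.

Let cexpN1 : cexpx (- k) 1 = 0 +i* (- B).
Proof.
by rewrite /cexpx /= !mulr1 cosN sinN cos_pihalf sin_pihalf mulr0 mulrN mulr1.
Qed.

Let ABN0 : (0 +i* (A + B) : R[i]) != 0.
Proof. by rewrite eq_complex /= eqxx/= gt_eqF// addr_gt0. Qed.

Let eN0 : e%:C != 0 :> R[i].
Proof. by rewrite eq_complex /= gt_eqF. Qed.

Let two0 : (2 : R[i]) != 0. Proof. by rewrite pnatr_eq0. Qed.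

(** The real part is 1 + e^2 / 2. Hence the division in [q] is legitimate, and its denominator may
    be dropped from upper bounds. *)
Let den_ge1 : 1 <= cabs (1 + k * e%:C / 2).
Proof.
apply: le_trans (Re_le_cabs _); apply: le_trans (ler_norm _).
have -> : k * e%:C / 2 = (e * e / 2) +i* (pi / 2 * e / 2).
  have -> : (2 : R[i])^-1 = (2^-1 : R)%:C.
    by rewrite -[2 in LHS](rmorph_nat (real_complex R)) -fmorphV.
  by apply: complex_eq; rewrite ?ReM ?ImM/=; ring.
rewrite ReD/= lerDl; nra.
Qed.

Let denN0 : 1 + k * e%:C / 2 != 0.
Proof.
by rewrite -cabs_eq0 gt_eqF// (lt_le_trans ltr01 den_ge1).
Qed.

Let den2N0 : 2 + k * e%:C != 0.
Proof.
rewrite (_ : _ + _ = 2 * (1 + k * e%:C / 2)) ?mulf_neq0//.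
by field.
Qed.

Let p1 x := al * (cexpx k x + -1 * cexpx (- k) x).
Let dp1 x := al * (k * cexpx k x + -1 * (- k * cexpx (- k) x)).
Let ddp1 x := al * (k * (k * cexpx k x) + -1 * (- k * (- k * cexpx (- k) x))).
(** The parabola takes over at 1 with the value 1 and the slope [k * tau] of [p1], since k coth k =
    k tanh e for this [k]. *)
Let p2 (x : R) := k * tau%:C * (x - 1)%:C + q * ((x - 1) ^+ 2 / 2)%:C + 1.
Let dp2 (x : R) := k * tau%:C * 1%:C + q * (x - 1)%:C.
Let ddp2 (x : R) := k * tau%:C * 0 + q * 1%:C.
Let b := p2 (1 + e) * cexpx k (1 + e).
Let p3 x := b * cexpx (- k) x.
Let dp3 x := b * (- k * cexpx (- k) x).
Let ddp3 x := b * (- k * (- k * cexpx (- k) x)).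

(* psi is a sine-like arc that vanishes at 0, continued by a parabola on
   [1, 1 + e] and by a decaying exponential; V = k^2 - psi''/psi lives on
   [1, 1 + e] and tends to a point mass at 1 as e tends to 0. *)
Let psi := glue (1 + e) (glue 1 p1 p2) p3.
Let dpsi := glue (1 + e) (glue 1 dp1 dp2) dp3.
Let ddpsi := glue (1 + e) (glue 1 ddp1 ddp2) ddp3.
Let V := glue (1 + e)
  (glue 1 (fun=> 0) (fun x => k ^+ 2 - q * (p2 x)^-1)) (fun=> 0).

Let lt11e : 1 < 1 + e. Proof. by rewrite ltrDl. Qed.

Let prim_lin : cprimitive (fun=> 1%:C) (fun x : R => (x - 1)%:C).
Proof.
apply: cprimitive_real; apply: rprimitive_derive => x; last exact: cvg_cst.
by apply: is_derive_eq; rewrite subr0.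
Qed.

Let prim_sqr : cprimitive (fun x : R => (x - 1)%:C)
  (fun x : R => ((x - 1) ^+ 2 / 2)%:C).
Proof.
have dl x : is_derive (x : R) (1 : R) (fun y : R => y - 1) 1.
  by apply: is_derive_eq; rewrite subr0.
apply: cprimitive_real; apply: rprimitive_derive => x; last first.
  exact: (is_derive_continuous dl).
have := is_deriveM (is_deriveM (dl x) (dl x))
  (is_derive_cst (2^-1 : R) (x : R) (1 : R)).
by move=> H; apply: (is_derive_eq H); rewrite /GRing.scale/= mulr0 add0r; field.
Qed.

Let prim_p2 : cprimitive dp2 p2.
Proof.
have := cprimitiveD (cprimitiveD (cprimitiveZ (k * tau%:C) prim_lin)
  (cprimitiveZ q prim_sqr)) (cprimitive_cst 1).
by apply: eq_cprimitive => x //; rewrite addr0.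
Qed.

Let ge11e : (1 + e < 1) = false. Proof. by rewrite ltNge (ltW lt11e). Qed.

Let prim1 : cprimitive dpsi psi.
Proof.
apply: cprimitive_glue; last 1 first.
- by rewrite /glue ge11e /p3 /b -mulrA cexpxN mulr1.
- apply: cprimitive_glue; last 1 first.
  + rewrite /p1 /p2 cexp1 cexpN1 /al subrr expr0n/= mul0r !mulr0 !add0r.
    rewrite [X in _^-1 * X = _](_ : _ = 0 +i* (A + B)) ?mulVf//.
    by apply: complex_eq; rewrite ?ReD ?ImD ?ReM ?ImM/=; ring.
  + apply/cprimitiveZ/cprimitiveD; first exact: cprimitive_cexpx.
    exact/cprimitiveZ/cprimitive_cexpx.
  + exact: prim_p2.
- exact/cprimitiveZ/cprimitive_cexpx.
Qed.

Let prim2 : cprimitive ddpsi dpsi.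
Proof.
apply: cprimitive_glue; last 1 first.
- rewrite /glue ge11e /dp3 mulrCA /b -[_ * cexpx k _ * _]mulrA cexpxN mulr1.
  rewrite /dp2 /p2 /q.
  have -> : 1 + e - 1 = e by ring.
  have -> : (e ^+ 2 / 2)%:C = e%:C ^+ 2 / 2 :> R[i].
    by rewrite rmorphM rmorphXn fmorphV rmorph_nat.
  by rewrite rmorph1; field; rewrite eN0 den2N0.
- apply: cprimitive_glue; last 1 first.
  + rewrite /dp1 /dp2 cexp1 cexpN1 subrr mulr0 addr0.
    have -> : tau%:C = al * (0 +i* (A - B)).
      apply: (mulfI ABN0); rewrite /al mulrA divff// mul1r.
      apply: complex_eq; rewrite ?ReM ?ImM/= /tau; field;
        by rewrite gt_eqF// addr_gt0.
    have -> : 0 +i* (A - B) = 0 +i* A + 0 +i* (- B) :> R[i].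
      by apply: complex_eq; rewrite ?ReD ?ImD/= ?addr0.
    by rewrite rmorph1; ring.
  + apply/cprimitiveZ/cprimitiveD; first exact/cprimitiveZ/cprimitive_cexpx.
    exact/cprimitiveZ/cprimitiveZ/cprimitive_cexpx.
  + apply: cprimitiveD; last exact: cprimitiveZ.
    exact/cprimitiveZ/cprimitive_cst.
- exact/cprimitiveZ/cprimitiveZ/cprimitive_cexpx.
Qed.

Let psi0 : psi 0 = 0.
Proof.
by rewrite /psi /glue (lt_trans ltr01 lt11e) ltr01 /p1 !cexpx0; ring.
Qed.

Let P (x : R) := 0 < x /\ x < 1 + e.

Let dom_cst (z : R[i]) : dominated P (fun=> 1) (fun=> z).
Proof. by exists (cabs z) => x _; rewrite mulr1. Qed.

Let dom_lin : dominated P (fun=> 1) (fun x => (x - 1)%:C).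
Proof.
exists 1 => x [x1 xe]; rewrite cabs_real mulr1 ler_norml.
by move: x1 xe e1'; lra.
Qed.

Let dom_sqr : dominated P (fun=> 1) (fun x => ((x - 1) ^+ 2 / 2)%:C).
Proof.
exists 1 => x [x1 xe]; rewrite cabs_real mulr1 ger0_norm; last first.
  by rewrite divr_ge0// sqr_ge0.
by move: x1 xe e1'; nra.
Qed.

Let dom_expN : dominated (fun x => 0 < x /\ 1 + e <= x)
  (fun x => expR (- e * x)) (cexpx (- k)).
Proof. exact: (dominated_cexpxN (1 + e) k). Qed.

Let decays : exists C, [/\ cdecay e C psi, cdecay e C dpsi & cdecay e C ddpsi].
Proof.
have dk := dominated_cexpx (1 + e) k; have dN := dominated_cexpx (1 + e) (- k).
have [C0 d0] : exists C, cdecay e C psi.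
  apply: (dominated_glue e0); last exact/dominatedZ.
  apply: dominated_glue_cst; first exact/dominatedZ/dominatedD/dominatedZ.
  apply: dominatedD => //; apply: dominatedD; exact: dominatedZ.
have [C1 d1] : exists C, cdecay e C dpsi.
  apply: (dominated_glue e0); last exact/dominatedZ/dominatedZ.
  apply: dominated_glue_cst; last by apply: dominatedD; exact: dominatedZ.
  apply/dominatedZ/dominatedD; first exact: dominatedZ.
  exact/dominatedZ/dominatedZ.
have [C2 d2] : exists C, cdecay e C ddpsi.
  apply: (dominated_glue e0); last exact/dominatedZ/dominatedZ/dominatedZ.
  apply: dominated_glue_cst; last by apply: dominatedD; exact: dominatedZ.
  apply/dominatedZ/dominatedD; first exact/dominatedZ/dominatedZ.
  exact/dominatedZ/dominatedZ/dominatedZ.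
exists (Num.max C0 (Num.max C1 C2)); split.
- by apply: cdecay_le d0; rewrite le_max lexx.
- by apply: cdecay_le d1; rewrite !le_max lexx orbT.
- by apply: cdecay_le d2; rewrite !le_max lexx !orbT.
Qed.

(** [q * e] is the increment of [dp2] over [[1, 1 + e]], to leading order [- k]. The correction 8 e
    consists of 2 e from [tau] and 6 e from [n * tau * e], by [n <= 3], [tau <= 2 * e] and
    [e <= 1]. *)
Let q_le : cabs q * e <= n * (1 + 8 * e).
Proof.
rewrite /q cabsM cabsN cabsV !cabsM cabs_real (gtr0_norm e0) -/n.
set X := cabs (1 + _ + _); set d := cabs (1 + k * e%:C / 2).
have -> : n * X / (e * d) * e = n * (X / d).
  by field; rewrite !gt_eqF// (lt_le_trans ltr01 den_ge1).
rewrite ler_wpM2l ?(ltW n0)//.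
have X1 : X <= 1 + 8 * e.
  rewrite (le_trans (cabsD _ _))// (le_trans (lerD (cabsD _ _) (lexx _)))//.
  rewrite cabs1 !cabsM !cabs_real (gtr0_norm e0) (ger0_norm tau0) -/n.
  have h : n * tau * e <= 6 * e.
    rewrite ler_wpM2r ?(ltW e0)// (le_trans (ler_pM (ltW n0) tau0 n3 tau_le))//.
    by move: e1'; lra.
  by move: tau_le h; lra.
rewrite (le_trans _ X1)// ler_pdivrMr ?(lt_le_trans ltr01 den_ge1)//.
by rewrite ler_peMr ?cabs_ge0.
Qed.

(** The parabola stays close to its value 1 at 1: its linear term is at most 6 e, and its quadratic
    term at most [cabs q * e * e], hence at most 14 e by [q_le]. *)
Let p2_ge (x : R) : 1 <= x -> x <= 1 + e -> 1 - 20 * e <= cabs (p2 x).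
Proof.
move=> x1 xe.
have s0 : 0 <= x - 1 by rewrite subr_ge0.
have se : x - 1 <= e by rewrite lerBlDl.
have : cabs (1 : R[i]) <= cabs (p2 x) + cabs (- (k * tau%:C * (x - 1)%:C))
    + cabs (- (q * ((x - 1) ^+ 2 / 2)%:C)).
  have -> : (1 : R[i]) = p2 x + - (k * tau%:C * (x - 1)%:C)
      + - (q * ((x - 1) ^+ 2 / 2)%:C) by rewrite /p2; ring.
  by rewrite (le_trans (cabsD _ _))// lerD// cabsD.
rewrite cabs1 !cabsN (cabsM (k * _)) (cabsM k) (cabsM q) !cabs_real.
rewrite (ger0_norm tau0) (ger0_norm s0) -/n.
rewrite ger0_norm ?divr_ge0 ?sqr_ge0//.
have h1 : n * tau * (x - 1) <= 6 * e.
  apply: (@le_trans _ _ (3 * (2 * e) * 1)); last by lra.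
  apply: ler_pM => //; first by rewrite mulr_ge0// ltW.
    exact: (ler_pM (ltW n0) tau0 n3 tau_le).
  by rewrite (le_trans se).
have h2 : cabs q * ((x - 1) ^+ 2 / 2) <= 14 * e.
  apply: (@le_trans _ _ (cabs q * (e * e))).
    by rewrite ler_wpM2l ?cabs_ge0//; nra.
  rewrite mulrA ler_wpM2r ?(ltW e0)// (le_trans q_le)//.
  apply: (@le_trans _ _ (3 * (1 + 8 * e))).
    rewrite ler_wpM2r// addr_ge0// mulr_ge0// ltW//.
  by move: e1; lra.
move: h1 h2; lra.
Qed.

Let den20 : 0 < 1 - 20 * e.
Proof. by move: e1; lra. Qed.

Let p2N0 (x : R) : 1 <= x -> x <= 1 + e -> p2 x != 0.
Proof.
by move=> x1 xe; rewrite -cabs_eq0 gt_eqF// (lt_le_trans den20)// p2_ge.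
Qed.

Let bound := n ^+ 2 + cabs q / (1 - 20 * e).

Let V_le (x : R) : 1 <= x -> x <= 1 + e ->
  cabs (k ^+ 2 - q * (p2 x)^-1) <= bound.
Proof.
move=> x1 xe; rewrite (le_trans (cabsD _ _))// cabsN (cabsM q) cabsV.
rewrite expr2 (cabsM k) -expr2 lerD// ler_wpM2l ?cabs_ge0//.
rewrite lef_pV2 ?posrE ?p2_ge//.
by rewrite (lt_le_trans den20)// p2_ge.
Qed.

Let bound0 : 0 <= bound.
Proof. by rewrite addr_ge0 ?sqr_ge0// divr_ge0 ?cabs_ge0 ?(ltW den20). Qed.

Let ode (x : R) : ddpsi x = k ^+ 2 * psi x - V x * psi x.
Proof.
rewrite /ddpsi /psi /V /glue; case: ltP => xe; last by rewrite /ddp3 /p3; ring.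
case: ltP => x1; first by rewrite /ddp1 /p1; ring.
by rewrite /ddp2 rmorph1; field; rewrite p2N0// ltW.
Qed.

Let measurable_V :
  measurable_fun [set: measurableTypeR R] (fun x => complex.Re (V x)) /\
  measurable_fun [set: measurableTypeR R] (fun x => complex.Im (V x)).
Proof.
have [[_ mr _] [_ mi _]] := prim_p2.
pose w (x : R) := (cabs (p2 x) ^+ 2)^-1.
have mw : measurable_fun [set: measurableTypeR R] w.
  (* Away from [[1, 1 + e]] the parabola may vanish. The real power -1 agrees with the inverse at 0
     too and is measurable everywhere. *)
  have -> : w = (fun x => (cabs (p2 x) ^+ 2) `^ (-1)).
    by apply/funext => x; rewrite powR_inv1 ?sqr_ge0.
  apply: (measurableT_comp (measurable_powR _)).
  apply: measurable_funX.
  exact: (@cmeasurable_cabs _ (measurableTypeR R) R setT p2 (conj mr mi)).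
have inv_re x : complex.Re (p2 x)^-1 = complex.Re (p2 x) * w x.
  by rewrite /w cabs_sqr; case: (p2 x).
have inv_im x : complex.Im (p2 x)^-1 = - complex.Im (p2 x) * w x.
  by rewrite /w cabs_sqr; case: (p2 x) => ? ?; rewrite mulNr.
have mir : measurable_fun [set: measurableTypeR R]
    (fun x => complex.Re (p2 x)^-1).
  under eq_fun do rewrite inv_re; exact: measurable_funM.
have mii : measurable_fun [set: measurableTypeR R]
    (fun x => complex.Im (p2 x)^-1).
  under eq_fun do rewrite inv_im; apply: measurable_funM => //.
  exact: measurable_funN.
have mc (r : R) : measurable_fun [set: measurableTypeR R] (fun=> r).
  exact: measurable_cst.
split.
- have -> : (fun x => complex.Re (V x)) = glue (1 + e) (glue 1 (fun=> 0)
      (fun x => complex.Re (k ^+ 2) - (complex.Re q * complex.Re (p2 x)^-1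
        - complex.Im q * complex.Im (p2 x)^-1))) (fun=> 0).
    by apply/funext => x; rewrite /V /glue; case: ifP => // _; case: ifP.
  do 2 (apply: measurable_glue => //).
  apply: measurable_funB => //.
  by apply: measurable_funB; exact: measurable_funM.
- have -> : (fun x => complex.Im (V x)) = glue (1 + e) (glue 1 (fun=> 0)
      (fun x => complex.Im (k ^+ 2) - (complex.Re q * complex.Im (p2 x)^-1
        + complex.Im q * complex.Re (p2 x)^-1))) (fun=> 0).
    by apply/funext => x; rewrite /V /glue; case: ifP => // _; case: ifP.
  do 2 (apply: measurable_glue => //).
  apply: measurable_funB => //.
  by apply: measurable_funD; exact: measurable_funM.
Qed.

Let cabs_V (x : R) : cabs (V x) <= bound.
Proof.
rewrite /V /glue; case: ltP => xe; last by rewrite cabs0 bound0.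
by case: ltP => x1; [rewrite cabs0 bound0|rewrite V_le// ltW].
Qed.

Let V0 (x : R) : ~ `[1, 1 + e[%classic x -> V x = 0.
Proof.
rewrite /= in_itv/= => xI; rewrite /V /glue; case: ltP => // xe.
by case: ltP => // x1; exfalso; apply: xI; rewrite x1.
Qed.

Let intV : cintegrable leb hl V.
Proof.
have [mr mi] := measurable_V.
have [C d] : exists C, cdecay e C V.
  apply: (dominated_glue e0).
    exists bound => x [x0 xe]; rewrite mulr1; have := cabs_V x.
    by rewrite /V /glue xe.
  by exists 0 => x _; rewrite cabs0 mul0r.
split.
  exact: (rdecay_integrable e0 mr (cdecay_Re d) (lexx 0)).
exact: (rdecay_integrable e0 mi (cdecay_Im d) (lexx 0)).
Qed.

Let L1_norm_V : L1_norm V <= bound * e.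
Proof.
have mhl := @measurable_half_line R.
have ihl := cintegrable_cabs mhl intV.
have sub : `[1, 1 + e[%classic `<=` hl.
  move=> x; rewrite /half_line/= !in_itv/= andbT => /andP[x1 _].
  exact: lt_le_trans x1.
have iI := integrableS mhl (measurableR_itv _) sub ihl.
rewrite /L1_norm.
have -> : \int[leb]_(x in hl) cabs (V x) =
    \int[leb]_(x in `[1, 1 + e[) cabs (V x).
  rewrite -[X in _ = Rintegral _ X _](setIidr sub) Rintegral_mkcondr.
  apply: eq_Rintegral => x _; rewrite patchE; case: ifPn => // /negP xI.
  by rewrite V0 ?cabs0// => xI'; apply: xI; rewrite inE.
have len : leb (`[1, 1 + e[%classic : set R) = e%:E.
  by rewrite lebesgue_measure_itv/= lte_fin lt11e -EFinB addrAC subrr add0r.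
apply: (@le_trans _ _ (\int[leb]_(x in `[1, 1 + e[) bound)).
  apply: le_Rintegral => //.
  apply: measurable_bounded_integrable => //.
    by rewrite [X in (X < _)%E]len ltry.
  by exists `|bound|; split; [exact: num_real|move=> y ry z _ /=; exact: ltW].
by rewrite Rintegral_cst// [X in fine X]len.
Qed.

(** On []1, 1 + e[], an interval of positive measure, [psi] is the parabola, which has no zero
    there. *)
Let psi_ne : ~ {ae leb, forall x, hl x -> psi x = 0}.
Proof.
move=> H.
have neg : leb.-negligible (`]1, 1 + e[%classic : set (measurableTypeR R)).
  apply: negligibleS H => x; rewrite /= in_itv/= => /andP[x1 xe] h.
  have := h _; rewrite /half_line/= in_itv/= (lt_trans ltr01 x1) => /(_ isT).
  rewrite /psi /glue xe ltNge (ltW x1)/= => /eqP.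
  by rewrite (negbTE (p2N0 (ltW x1) (ltW xe))).
have /negligibleP := neg; move=> /(_ (measurableR_itv _)).
rewrite [LHS](lebesgue_measure_itv `]1, 1 + e[)/= lte_fin lt11e -EFinB => -[].
by rewrite addrAC subrr add0r => /eqP; rewrite gt_eqF.
Qed.

Lemma near_extremal_potential : exists (V : measurableTypeR R -> R[i])
    (intV : cintegrable leb hl V) (lambda : R[i]),
  [/\ off_half_axis lambda,
      schrodinger_eigenvalue (function_potential intV) lambda &
      L1_norm V <= Num.sqrt (cabs lambda) * (1 + 38 * e)].
Proof.
exists V, intV, (- k ^+ 2); split.
- rewrite /off_half_axis lecE negb_and; apply/orP; left.
  rewrite ImN expr2 ImM /=; have := @pihalf_02 R => /andP[p0 _].
  by rewrite oppr_eq0 gt_eqF// addr_gt0// mulr_gt0.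
- have [C [d0 d1 d2]] := decays.
  have ode' (x : R) (_ : 0 < x) := ode x.
  exact: (explicit_eigenvalue _ e0 prim1 prim2 psi0 d0 d1 d2 ode' psi_ne).
- have -> : Num.sqrt (cabs (- k ^+ 2)) = n.
    by rewrite cabsN expr2 cabsM -expr2 sqrtr_sqr ger0_norm ?cabs_ge0.
  rewrite (le_trans L1_norm_V)// /bound mulrDl.
  (* The first summand absorbs [n ^+ 2 * e], by [n <= 3]; the second absorbs the main term
     [cabs q * e / (1 - 20 * e)]. *)
  have -> : n * (1 + 38 * e) = n * (3 * e) + n * (1 + 35 * e) by ring.
  rewrite lerD//.
    by rewrite expr2 -mulrA ler_wpM2l ?(ltW n0)// ler_wpM2r ?(ltW e0).
  rewrite mulrAC ler_pdivrMr// (le_trans q_le)// -mulrA ler_wpM2l ?(ltW n0)//.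
  (* Here (1 + 35 e)(1 - 20 e) - (1 + 8 e) = 7 e (1 - 100 e), which is where [e <= 100^-1] comes
     from. *)
  by move: e0 e1; nra.
Qed.

End sharpness.

Lemma sharpness (R : realType) (kappa : R) : kappa < 1 ->
  exists (V : measurableTypeR R -> R[i])
    (intV : cintegrable lebesgue_measure (half_line R) V) (lambda : R[i]),
  [/\ off_half_axis lambda,
      schrodinger_eigenvalue (function_potential intV) lambda &
      kappa * L1_norm V < Num.sqrt (cabs lambda)].
Proof.
(* The estimate of the norm is to be multiplied by the constant, so a negative [kappa] is first
   raised to 0. *)
move=> k1; pose kp := Num.max kappa 0.
have kp0 : 0 <= kp by rewrite le_max lexx orbT.
have kp1 : kp < 1 by rewrite gt_max k1 ltr01.
(* Then [kp * (1 + 38 * e) <= kp + 38 * e < kp + 100 * e = 1], and the denominator 100 also ensures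
   [e <= 100^-1]. *)
pose e := (1 - kp) / 100.
have e0 : 0 < e by rewrite divr_gt0// subr_gt0.
have e1 : e <= 100^-1 by rewrite ler_piMl ?invr_ge0//; lra.
have [V [intV [lambda [ol ev L1]]]] := near_extremal_potential e0 e1.
exists V, intV, lambda; split => //.
have L0 : 0 <= L1_norm V by apply: Rintegral_ge0 => x _; exact: cabs_ge0.
apply: (@le_lt_trans _ _ (kp * L1_norm V)).
  by rewrite ler_wpM2r// le_max lexx.
have s0 : 0 < Num.sqrt (cabs lambda).
  rewrite sqrtr_gt0 lt_neqAle eq_sym cabs_eq0 cabs_ge0 andbT.
  by apply: contraNneq ol => ->.
rewrite (le_lt_trans (ler_wpM2l kp0 L1))// mulrCA gtr_pMr//.
have h1 : 100 * e = 1 - kp by rewrite /e; field.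
have h2 : kp * e <= e by rewrite ler_piMl// ltW.
by rewrite mulrDr mulr1 mulrCA; lra.
Qed.

Theorem corollary1p4 (R : realType) :
  (* finite complex Borel measures *)
  (forall (V : potential R) (lambda : R[i]),
      off_half_axis lambda ->
      schrodinger_eigenvalue V lambda ->
      ((Num.sqrt (cabs lambda))%:E <= complex_total_variation V (half_line R))%E)
  /\
  (* integrable functions *)
  (forall (V : measurableTypeR R -> R[i])
          (intV : cintegrable lebesgue_measure (half_line R) V)
          (lambda : R[i]),
      off_half_axis lambda ->
      schrodinger_eigenvalue (function_potential intV) lambda ->
      Num.sqrt (cabs lambda) <= L1_norm V)
  /\
  (* sharpness of the constant 1 *)
  (forall kappa : R, kappa < 1 ->
      exists (V : measurableTypeR R -> R[i])
             (intV : cintegrable lebesgue_measure (half_line R) V)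
             (lambda : R[i]),
        [/\ off_half_axis lambda,
            schrodinger_eigenvalue (function_potential intV) lambda &
            kappa * L1_norm V < Num.sqrt (cabs lambda)]).
Proof.
split; first exact: eigenvalue_bound_total_variation.
by split; [exact: eigenvalue_bound_L1_norm|exact: sharpness].
Qed.
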